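(* Let $\Omega^\delta_\diamondsuit$ be a simply connected discrete domain on a $\delta$-isoradial graph. If $F:\Omega^\delta_\diamondsuit\to\mathbb C$ is s-holomorphic, then (i) a real-valued function $H$ on $\Omega^\delta_\Lambda$ is well defined, up to an additive constant, by $$H(u)-H(w):=2\delta\cdot\big|\mathrm{Proj}\big[F(z);[i(w-u)]^{-\frac12}\big]\big|^2$$ for every edge $[uw]$ ($u\in\Gamma$, $w\in\Gamma^*$) of a rhombus with center $z\in\Omega^\delta_\diamondsuit$ (the right-hand side being the same for both rhombi containing the edge); (ii) for any neighboring $v_1,v_2\in\Omega^\delta_\Gamma\subset\Gamma$ or $v_1,v_2\in\Omega^\delta_{\Gamma^*}\subset\Gamma^*$ (opposite vertices of a rhombus with center $\frac12(v_1+v_2)\in\Omega^\delta_\diamondsuit$) the identity $$H(v_2)-H(v_1)=\mathrm{Im}\big[(v_2-v_1)\,(F(\tfrac12(v_1+v_2)))^2\big]$$ holds; (iii) $H$ is discrete subharmonic on $\Gamma$ and discrete superharmonic on $\Gamma^*$, i.e. $$[\Delta^\delta H](u)\ge0\quad\text{and}\quad[\Delta^\delta H](w)\le0$$ for all $u\in\mathrm{Int}\,\Omega^\delta_\Gamma\subset\Gamma$ and $w\in\mathrm{Int}\,\Omega^\delta_{\Gamma^*}\subset\Gamma^*$.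
   Context: **Lattice.** Let $\delta>0$. A planar graph $\Gamma$ embedded in $\mathbb C$ is $\delta$-isoradial if each face is inscribed in a circle of radius $\delta$; the circle centers are assumed to lie inside the faces and are the vertices of the dual graph $\Gamma^*$ (also $\delta$-isoradial). $\Lambda=\Gamma\cup\Gamma^*$, with edges $[uw]$ joining $u\in\Gamma$ to the center $w\in\Gamma^*$ of an incident face; the faces of $\Lambda$ are rhombi $u_1w_1u_2w_2$ with side $\delta$, and $\diamondsuit$ is the set of rhombi centers. All rhombi angles lie in $[\eta,\pi-\eta]$ for some fixed $\eta>0$. **Discrete domains.** A simply connected discrete domain $\Omega^\delta_\diamondsuit\subset\diamondsuit$ corresponds to a simply connected polygonal domain $\Omega^\delta$ composed of inner rhombi and boundary half-rhombi (triangles cut off from rhombi by a diagonal lying on $\partial\Omega^\delta$); $\Omega^\delta_\diamondsuit$ is the set of centers of these rhombi and half-rhombi. $\Omega^\delta_\Lambda,\Omega^\delta_\Gamma,\Omega^\delta_{\Gamma^*}$ are the sets of vertices (in $\Lambda,\Gamma,\Gamma^*$) of the rhombi with centers in $\Omega^\delta_\diamondsuit$ (all four vertices, also for boundary half-rhombi); $\mathrm{Int}\,\Omega^\delta_\Gamma$, $\mathrm{Int}\,\Omega^\delta_{\Gamma^*}$ are the vertices in the interior of $\Omega^\delta$. $z_0\sim z_1$ if the (half-)rhombi share an edge of $\Lambda$. **s-holomorphicity.** $\mathrm{Proj}[X;u]=\frac X2+\frac{\overline Xu^2}{2|u|^2}$ is the orthogonal projection of $X$ on $u\mathbb R$. $F$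 is s-holomorphic if $\mathrm{Proj}[F(z_0);[i(w-u)]^{-1/2}]=\mathrm{Proj}[F(z_1);[i(w-u)]^{-1/2}]$ for all $z_0\sim z_1$ in $\Omega^\delta_\diamondsuit$ with common edge $[uw]$, $u\in\Gamma$, $w\in\Gamma^*$. **Discrete Laplacian.** For $u\in\Gamma$ with neighbors $u_s$ in $\Gamma$, $[\Delta^\delta H](u)=\frac1{\mu(u)}\sum_{u_s\sim u}\tan\theta_s\,[H(u_s)-H(u)]$, $\mu(u)=\frac12\delta^2\sum_{u_s\sim u}\sin2\theta_s$, where $\theta_s$ is the half-angle at $u$ of the rhombus with diagonal $[uu_s]$. The same definition is used on $\Gamma^*$ (with half-angles at the white vertex).
   Formalization: A boundary or outer vertex reached by several half-rhombi with no common side counts as several vertices for H, and right-hand sides agree only on edges of the (half-)rhombi themselves; the domain may not lie on both sides of a boundary diagonal. Otherwise (i) can fail at a reflex boundary vertex. *)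

(* Defs.v *)
From Stdlib Require Export Reals Lra.
From Stdlib Require Import Relations ClassicalEpsilon.
From Coquelicot Require Export Coquelicot.

Set Implicit Arguments.
Unset Strict Implicit.

Open Scope R_scope.

(** * Complex numbers *)

(* Principal branch, with a cut along the negative half-line. *)
Definition Csqrt (z : C) : C :=
  (sqrt ((Cmod z + Re z) / 2),
   (if Rle_dec 0 (Im z) then 1 else -1) * sqrt ((Cmod z - Re z) / 2)).

Definition inv_sqrt (z : C) : C := (/ Csqrt z)%C.

Definition expi (t : R) : C := (cos t, sin t).

Definition Proj (X u : C) : C :=
  (X / 2 + Cconj X * u ^ 2 / (2 * RtoC (Cmod u ^ 2)))%C.

Lemma Csqrt_sq (z : C) : (Csqrt z ^ 2)%C = z.
Proof.
destruct z as [x y].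
assert (Hm : 0 <= Cmod (x, y)) by apply Cmod_ge_0.
assert (H2 : Cmod (x, y) * Cmod (x, y) = x * x + y * y).
{ unfold Cmod; simpl. rewrite sqrt_sqrt by nra. ring. }
assert (Hx : - Cmod (x, y) <= x <= Cmod (x, y)) by nra.
unfold Csqrt; simpl Re; simpl Im.
set (m := Cmod (x, y)) in *.
assert (Ha : sqrt ((m + x) / 2) * sqrt ((m + x) / 2) = (m + x) / 2).
{ apply sqrt_sqrt; lra. }
assert (Hb : sqrt ((m - x) / 2) * sqrt ((m - x) / 2) = (m - x) / 2).
{ apply sqrt_sqrt; lra. }
assert (Hc : 2 * (sqrt ((m + x) / 2) * sqrt ((m - x) / 2)) = Rabs y).
{ rewrite <- sqrt_mult by lra.
  replace ((m + x) / 2 * ((m - x) / 2)) with (Rsqr (y / 2)).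
  - rewrite sqrt_Rsqr_abs, Rabs_div, (Rabs_pos_eq 2) by lra. field.
  - unfold Rsqr. nra. }
set (a := sqrt ((m + x) / 2)) in *.
set (b := sqrt ((m - x) / 2)) in *.
unfold Cpow, Cmult, RtoC; simpl.
destruct (Rle_dec 0 y) as [Hy | Hy].
- rewrite Rabs_pos_eq in Hc by lra. f_equal; nra.
- rewrite Rabs_left in Hc by lra. f_equal; nra.
Qed.

(* The projection depends on [u] only through [u ^ 2], so the branch of the
   square root is immaterial. *)
Lemma Proj_inv_sqrt (X z nu : C) :
  z <> 0%C -> (nu ^ 2)%C = (/ z)%C -> Proj X nu = Proj X (inv_sqrt z).
Proof.
intros Hz Hnu.
assert (H0 : Csqrt z <> 0%C).
{ intro H. apply Hz. rewrite <- (Csqrt_sq z), H. ring. }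
assert (Hs : (inv_sqrt z ^ 2)%C = (/ z)%C).
{ unfold inv_sqrt. rewrite <- (Csqrt_sq z) at 2. field. exact H0. }
assert (Hmod : forall w : C, Cmod w ^ 2 = Cmod (w ^ 2)).
{ intro w. simpl. rewrite !Cmod_mult, Cmod_1. reflexivity. }
unfold Proj. rewrite !Hmod, Hs, Hnu. reflexivity.
Qed.

(* Twice the signed area of the triangle 0, a, b. *)
Definition cross (a b : C) : R := Im (Cconj a * b)%C.

(** * Plane figures *)

Definition open_rhombus (a b d x : C) : Prop :=
  exists s t : R, 0 < s < 1 /\ 0 < t < 1 /\
    x = (a + RtoC s * (b - a) + RtoC t * (d - a))%C.

Definition closed_rhombus (a b d x : C) : Prop :=
  exists s t : R, 0 <= s <= 1 /\ 0 <= t <= 1 /\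
    x = (a + RtoC s * (b - a) + RtoC t * (d - a))%C.

Definition open_triangle (a b d x : C) : Prop :=
  exists s t : R, 0 < s /\ 0 < t /\ s + t < 1 /\
    x = (a + RtoC s * (b - a) + RtoC t * (d - a))%C.

Definition closed_triangle (a b d x : C) : Prop :=
  exists s t : R, 0 <= s /\ 0 <= t /\ s + t <= 1 /\
    x = (a + RtoC s * (b - a) + RtoC t * (d - a))%C.

Definition segment (b d x : C) : Prop :=
  exists t : R, 0 <= t <= 1 /\ x = (b + RtoC t * (d - b))%C.

Definition frontier (D : C -> Prop) (x : C) : Prop :=
  ~ locally x D /\ ~ locally x (fun y => ~ D y).

(* Paths and homotopies are parametrised by [0, 1] and [0, 1]^2 but given as
   continuous maps on R and R^2; any continuous map on [0, 1] or [0, 1]^2 has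
   such an extension. *)
Definition simply_connected (D : C -> Prop) : Prop :=
  (forall x y : C, D x -> D y ->
     exists g : R -> C,
       (forall t, continuous g t) /\
       (forall t, 0 <= t <= 1 -> D (g t)) /\ g 0 = x /\ g 1 = y) /\
  (forall g : R -> C,
     (forall t, continuous g t) ->
     (forall t, 0 <= t <= 1 -> D (g t)) -> g 0 = g 1 ->
     exists K : R * R -> C,
       (forall p, continuous K p) /\
       (forall s t, 0 <= s <= 1 -> 0 <= t <= 1 -> D (K (s, t))) /\
       (forall t, 0 <= t <= 1 -> K (0, t) = g t) /\
       (forall t, 0 <= t <= 1 -> K (1, t) = g 0) /\
       (forall s, 0 <= s <= 1 -> K (s, 0) = g 0 /\ K (s, 1) = g 0)).

(** * Isoradial lattices *)

(* [black] is the vertex set of Gamma and [white] that of its dual, that is,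
   the set of circumcentres of the faces of Gamma.  The neighbours in Lambda of
   a vertex v of either colour are  v + delta * exp (i * arg v k),  listed
   counterclockwise; the list has [deg v] elements and is continued
   periodically in k.  For white v they are the vertices of the face of Gamma
   with centre v, and for black v those of the face of the dual with
   centre v. *)
Record lattice : Type := Lattice {
  black : C -> Prop;
  white : C -> Prop;
  deg : C -> nat;
  arg : C -> nat -> R }.

Section Lattice_geometry.

Variables (delta : R) (L : lattice).

Definition Lam (v : C) : Prop := black L v \/ white L v.

Definition nb (v : C) (k : nat) : C :=
  (v + RtoC delta * expi (arg L v k))%C.

(* The rhombus between the k-th and the (k+1)-st edges of Lambda at v. *)
Definition opp (v : C) (k : nat) : C := (nb v k + nb v (S k) - v)%C.
Definition center (v : C) (k : nat) : C := ((v + opp v k) / 2)%C.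
Definition half_angle (v : C) (k : nat) : R :=
  (arg L v (S k) - arg L v k) / 2.

Definition face (w x : C) : Prop :=
  forall k : nat, 0 < cross (nb w (S k) - nb w k)%C (x - nb w k)%C.
Definition closed_face (w x : C) : Prop :=
  forall k : nat, 0 <= cross (nb w (S k) - nb w k)%C (x - nb w k)%C.

(* [polygon_turn] and [polygon_period] say that the face with centre v is a
   polygon inscribed in the circle of radius delta about v, with v inside it.
   [dual_edge]: v and [opp v k] are consecutive vertices of the face with
   centre [nb v (S k)], so that the edge of the face of centre v joining
   [nb v k] to [nb v (S k)] is dual to the edge joining v to [opp v k].
   Exchanging the two ends, these are also consecutive, in the reverse order,
   in the face with centre [nb v k].  The last two conditions say that the
   polygons about the white vertices are the faces of a graph embedded in the
   plane. *)
Record isoradial : Prop := Isoradial {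
  colour_disjoint : forall v, ~ (black L v /\ white L v);
  black_nb : forall u k, black L u -> white L (nb u k);
  white_nb : forall w k, white L w -> black L (nb w k);
  polygon_turn : forall v k, Lam v -> 0 < arg L v (S k) - arg L v k < PI;
  polygon_period : forall v k, Lam v ->
    arg L v (k + deg L v) = arg L v k + 2 * PI;
  dual_edge : forall v k, Lam v ->
    exists j, nb (nb v (S k)) j = v /\ nb (nb v (S k)) (S j) = opp v k;
  face_disjoint : forall w1 w2 x, white L w1 -> white L w2 ->
    face w1 x -> face w2 x -> w1 = w2;
  face_cover : forall x, exists w, white L w /\ closed_face w x }.

Definition angles_bounded (eta : R) : Prop :=
  forall v k, Lam v -> eta <= arg L v (S k) - arg L v k <= PI - eta.

(* a, b, c, d are the vertices, in counterclockwise order and starting from a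
   vertex of either colour, of the face of Lambda with centre z. *)
Definition rhombus (z a b c d : C) : Prop :=
  Lam a /\ exists k : nat,
    b = nb a k /\ c = opp a k /\ d = nb a (S k) /\ z = center a k.

Definition rhombus_edge (z u w : C) : Prop :=
  black L u /\ white L w /\
  ((exists c d, rhombus z u w c d) \/ (exists b c, rhombus z u b c w)).

(** * Discrete domains *)

Section Domain.

Variable Om : C -> Prop.

Definition inner_cell (z : C) : Prop :=
  exists a b c d, rhombus z a b c d /\ forall x, open_rhombus a b d x -> Om x.

(* The half-rhombus with apex a is the triangle a b d. *)
Definition half_cell (z a : C) : Prop :=
  exists b c d, rhombus z a b c d /\
    (forall x, open_triangle a b d x -> Om x) /\
    (forall x, segment b d x -> frontier Om x).

(* The set of the centres of the rhombi and half-rhombi composing Om. *)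
Definition cell (z : C) : Prop := inner_cell z \/ exists a, half_cell z a.

(* The boundary consists of diagonals, and Om does not lie on both sides of a
   boundary diagonal, so that a centre belongs to only one (half-)rhombus. *)
Record discrete_domain : Prop := DiscreteDomain {
  domain_nonempty : exists x, Om x;
  domain_open : open Om;
  domain_composed : forall x, Om x ->
    exists z a b c d, rhombus z a b c d /\
      ((inner_cell z /\ closed_rhombus a b d x) \/
       (half_cell z a /\ closed_triangle a b d x));
  domain_boundary : forall x, frontier Om x ->
    exists z a b c d, rhombus z a b c d /\ half_cell z a /\ segment b d x;
  domain_no_slit : forall z a a', half_cell z a -> half_cell z a' -> a = a' }.

(* [uw] is a side of the inner rhombus, or of the boundary half-rhombus, with
   centre z; a half-rhombus has only the two sides ending at its apex. *)
Definition cell_edge (z u w : C) : Prop :=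
  rhombus_edge z u w /\ (inner_cell z \/ half_cell z u \/ half_cell z w).

Definition s_holomorphic (F : C -> C) : Prop :=
  forall z0 z1 u w, cell_edge z0 u w -> cell_edge z1 u w ->
    Proj (F z0) (inv_sqrt (Ci * (w - u))%C) =
    Proj (F z1) (inv_sqrt (Ci * (w - u))%C).

(* Vertices of the discrete domain are represented by corners: a centre z
   together with one of the four vertices v of its rhombus.  *)
Definition corner (z v : C) : Prop :=
  cell z /\ exists b c d, rhombus z v b c d.

(* All the corners at an interior point v are the same vertex.  At a point
   outside Om, corners are identified only across common sides of
   (half-)rhombi: a point of the plane counts as several vertices if it is
   the outer vertex of several half-rhombi, or if Om reaches it from several
   sides.  Around such a point the increments of H need not match. *)
Definition share_vertex (v z0 z1 : C) : Prop :=
  corner z0 v /\ corner z1 v /\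
  (Om v \/
   exists u w, cell_edge z0 u w /\ cell_edge z1 u w /\ (v = u \/ v = w)).

Definition same_vertex (v : C) : C -> C -> Prop :=
  clos_refl_sym_trans C (share_vertex v).

(* H z v is the value at the vertex represented by the corner (z, v). *)
Definition vertex_function (H : C -> C -> R) : Prop :=
  forall v z0 z1, same_vertex v z0 z1 -> H z0 v = H z1 v.

(* When no point of the plane counts as several vertices, such a function is
   just a function on a set of points of the plane. *)
Lemma vertex_function_point (H : C -> C -> R) :
  (forall v z0 z1, corner z0 v -> corner z1 v -> same_vertex v z0 z1) ->
  vertex_function H ->
  exists h : C -> R, forall z v, corner z v -> H z v = h v.
Proof.
intros Hs HH.
exists (fun v => H (epsilon (inhabits (RtoC 0)) (fun z => corner z v)) v).
intros z v Hz. apply HH, Hs; [exact Hz |].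
apply epsilon_spec. exists z; exact Hz.
Qed.

Definition has_increments (F : C -> C) (H : C -> C -> R) : Prop :=
  forall z u w, cell z -> rhombus_edge z u w ->
    H z u - H z w =
    2 * delta * Cmod (Proj (F z) (inv_sqrt (Ci * (w - u))%C)) ^ 2.

End Domain.

(** * Discrete Laplacian *)

Definition weight (v : C) : R :=
  / 2 * delta ^ 2 *
  sum_f_R0 (fun k => sin (2 * half_angle v k)) (pred (deg L v)).

(* The neighbours of v in the graph of its own colour are the [opp v k]. *)
Definition laplacian (H : C -> C -> R) (v : C) : R :=
  / weight v *
  sum_f_R0 (fun k => tan (half_angle v k) *
                     (H (center v k) (opp v k) - H (center v k) v))
           (pred (deg L v)).

End Lattice_geometry.

(* Main.v *)
Require Import Defs.
From Stdlib Require Import Lia ZArith Relations ClassicalEpsilon.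

(* By the definition of the projection, 2 delta |Proj[F(z); (i (w - u))^(-1/2)]|^2
   equals delta |F(z)|^2 - Im[(w - u) F(z)^2].  Hence on the rhombus with centre z
   the function v |-> Im[(v - z) F(z)^2], increased by delta |F(z)|^2 at the black
   vertices, has the required increments, and its differences along diagonals are
   those of (ii).  By s-holomorphicity the functions of two cells with a common
   side differ by a constant on that side, so on each star of rhombi about a vertex
   they fit together after adding constants; a homotopy argument glues these local
   choices over the simply connected domain.  That requires the local structure of
   the tiling near a point of the domain, which comes from the fact that rhombi do
   not overlap: each rhombus consists of two triangles lying in faces of Gamma.

   For (iii), let theta_k be the half-angles at a black vertex, x_k the coordinate
   of F on the direction attached to the k-th edge.  Then the k-th term of the
   Laplacian is 2 delta q(theta_k, x_k, x_{k+1}) with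
   q(t, x, y) = (cos t (x^2 + y^2) - 2 x y) / sin t.  Minimizing over the middle
   variable gives q(s, x, y) + q(t, y, z) >= q(s + t, x, z).  As the theta_k add up
   to pi, and as x changes sign after a full turn, the sum is nonnegative in view
   of q(pi - t, x, y) + q(t, y, - x) = 0.  At a white vertex all signs change. *)

(** * Primitives on simply connected domains *)

(** The obstacle is that cells meet along sides and at vertices, whereas the homotopy argument
    concerns an open subset of the plane. The local potentials are therefore indexed by lattice
    vertices: that of [a] lives on the open star of [a], and on each cell it is the constant making
    the function of the cell vanish at [a]. Comparing the potentials of two stars near a common
    point, three cases occur. A lattice vertex lies in no star but its own. Inside a rhombus there
    is only one cell. On a side, a star centre that is not an end of the side determines the cell,
    and if both centres are ends, s-holomorphicity applies. The resulting function on [Om] is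
    constant on each open cell, and this constant is what is added to the function of the cell.
    Vertices outside [Om] are handled through the midpoint of a common side, which always belongs to
    [Om]. *)

Lemma ball_C_iff (x y : C) (r : R) :
  ball x r y <-> Rabs (fst y - fst x) < r /\ Rabs (snd y - snd x) < r.
Proof. split; intro H; exact H. Qed.

(** Connectedness of [0, 1], reduced to the fact that a function with zero derivative is
    constant. *)
Lemma locally_const_eq (f : R -> R) :
  (forall t, 0 <= t <= 1 -> locally t (fun s => 0 <= s <= 1 -> f s = f t)) ->
  f 0 = f 1.
Proof.
intros Hf.
(* Clamping to [0, 1] is 1-Lipschitz, so [f] composed with [c] is locally constant on all of R, also
   at the end points. *)
set (c := fun t : R => Rmax 0 (Rmin 1 t)).
assert (Hc : forall t, 0 <= c t <= 1).
{ intro t. unfold c. split; [apply Rmax_l |].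
  apply Rmax_lub; [lra | apply Rmin_l]. }
assert (Hc0 : forall t, 0 <= t <= 1 -> c t = t).
{ intros t Ht. unfold c. rewrite Rmin_right, Rmax_right; lra. }
assert (Hlip : forall s t, Rabs (c s - c t) <= Rabs (s - t)).
{ intros s t. unfold c, Rmax, Rmin.
  repeat destruct Rle_dec; unfold Rabs; repeat destruct Rcase_abs; lra. }
assert (E : f (c 0) = f (c 1)).
{ apply (eq_is_derive (fun t => f (c t)) 0 1); [| lra].
  intros t _.
  apply is_derive_ext_loc with (fun _ => f (c t)).
  - destruct (Hf (c t) (Hc t)) as [e He]. exists e. intros s Hs.
    symmetry. apply He; [| apply Hc].
    apply Rle_lt_trans with (2 := Hs). apply Hlip.
  - apply @is_derive_const. }
rewrite !Hc0 in E by lra. exact E.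
Qed.

Fixpoint rsum (f : nat -> R) (n : nat) : R :=
  match n with O => 0 | S m => rsum f m + f m end.

Lemma rsum_ext (f g : nat -> R) (n : nat) :
  (forall i, (i < n)%nat -> f i = g i) -> rsum f n = rsum g n.
Proof.
induction n as [| n IH]; simpl; intros H; [reflexivity |].
rewrite IH, H by auto. reflexivity.
Qed.

Lemma rsum_double (f : nat -> R) (n : nat) :
  rsum f (2 * n) = rsum (fun i => f (2 * i)%nat + f (S (2 * i))) n.
Proof.
induction n as [| n IH]; [reflexivity |].
replace (2 * S n)%nat with (S (S (2 * n))) by lia. cbn [rsum]. rewrite IH. ring.
Qed.

Lemma rsum_add (f : nat -> R) (n m : nat) :
  rsum f (n + m) = rsum f n + rsum (fun i => f (n + i)%nat) m.
Proof.
induction m as [| m IH]; simpl.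
- rewrite Nat.add_0_r. ring.
- rewrite Nat.add_succ_r. simpl. rewrite IH. ring.
Qed.

Lemma rsum_telescope (f : nat -> R) (n : nat) :
  rsum (fun i => f (S i) - f i) n = f n - f O.
Proof. induction n as [| n IH]; simpl; [ring | rewrite IH; ring]. Qed.

Definition seg (x y : C) (t : R) : C := (x + RtoC t * (y - x))%C.

Lemma seg_0 (x y : C) : seg x y 0 = x.
Proof. unfold seg. ring. Qed.

Lemma seg_1 (x y : C) : seg x y 1 = y.
Proof. unfold seg. ring. Qed.

Lemma Rabs_convex (c x y r t : R) :
  Rabs (x - c) < r -> Rabs (y - c) < r -> 0 <= t <= 1 ->
  Rabs (x + t * (y - x) - c) < r.
Proof.
intros H1 H2 Ht.
replace (x + t * (y - x) - c) with ((1 - t) * (x - c) + t * (y - c)) by ring.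
apply Rle_lt_trans with (1 := Rabs_triang _ _).
rewrite !Rabs_mult, (Rabs_pos_eq t), (Rabs_pos_eq (1 - t)) by lra.
destruct (Req_dec t 0) as [-> | H0]; [lra |].
assert (t * Rabs (y - c) < t * r) by (apply Rmult_lt_compat_l; lra).
assert ((1 - t) * Rabs (x - c) <= (1 - t) * r) by (apply Rmult_le_compat_l; lra).
lra.
Qed.

Lemma seg_ball (c x y : C) (r t : R) :
  ball c r x -> ball c r y -> 0 <= t <= 1 -> ball c r (seg x y t).
Proof.
rewrite !ball_C_iff. intros [H1 H2] [H3 H4] Ht.
unfold seg; simpl. split.
- generalize (Rabs_convex _ _ _ _ t H1 H3 Ht). apply Rle_lt_trans.
  right. f_equal. ring.
- generalize (Rabs_convex _ _ _ _ t H2 H4 Ht). apply Rle_lt_trans.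
  right. f_equal. ring.
Qed.

(** For [s = t] the radius is 0 and the strict ball is empty, hence the second alternative; the
    summand 1 makes the inequality strict otherwise. *)
Lemma seg_lip (x y : C) (s t : R) :
  ball (seg x y t) ((Rabs (s - t)) * (1 + Rabs (fst y - fst x) + Rabs (snd y - snd x))) (seg x y s)
  \/ s = t.
Proof.
destruct (Req_dec s t) as [-> | Hst]; [right; reflexivity | left].
assert (0 < Rabs (s - t)) by (apply Rabs_pos_lt; lra).
rewrite ball_C_iff. unfold seg; simpl.
assert (A := Rabs_pos (fst y - fst x)). assert (B := Rabs_pos (snd y - snd x)).
assert (A' := Rmult_le_pos _ _ (Rlt_le _ _ H) A).
assert (B' := Rmult_le_pos _ _ (Rlt_le _ _ H) B).
split.
- replace (fst x + (s * (fst y + - fst x) - 0 * (snd y + - snd x)) -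
    (fst x + (t * (fst y + - fst x) - 0 * (snd y + - snd x))))
   with ((s - t) * (fst y - fst x)) by ring.
  rewrite Rabs_mult. nra.
- replace (snd x + (s * (snd y + - snd x) + 0 * (fst y + - fst x)) -
    (snd x + (t * (snd y + - snd x) + 0 * (fst y + - fst x))))
   with ((s - t) * (snd y - snd x)) by ring.
  rewrite Rabs_mult. nra.
Qed.

Lemma seg_continuous (x y : C) (t : R) : continuous (seg x y) t.
Proof.
intros P [e He].
set (M := 1 + Rabs (fst y - fst x) + Rabs (snd y - snd x)).
assert (HM : 0 < M).
{ unfold M. pose proof (Rabs_pos (fst y - fst x)).
  pose proof (Rabs_pos (snd y - snd x)). lra. }
assert (Hd : 0 < e / M) by (apply Rdiv_lt_0_compat; [apply cond_pos | exact HM]).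
exists (mkposreal _ Hd). intros s Hs. apply He.
destruct (seg_lip x y s t) as [H | ->]; [| apply ball_center].
apply ball_le with (2 := H). fold M.
change (Rabs (s - t) < e / M) in Hs.
apply Rmult_lt_compat_r with (r := M) in Hs; [| exact HM].
replace (e / M * M) with (pos e) in Hs by (field; lra). lra.
Qed.

Lemma locally_seg (x y : C) (P : C -> Prop) (t : R) :
  locally (seg x y t) P -> locally t (fun s => P (seg x y s)).
Proof. intro H. exact (seg_continuous x y t P H). Qed.

Section Potential.

(** A family of potentials [p a] on open sets [V a], whose differences on overlaps form a locally
    constant cocycle. The section shows that this cocycle is trivial when the union of the [V a] is
    simply connected. *)
Variables (V : C -> C -> Prop) (p : C -> C -> R).

Hypothesis V_open : forall a x, V a x -> locally x (V a).
Hypothesis V_compat : forall a b x, V a x -> V b x ->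
  locally x (fun y => p a y - p b y = p a x - p b x).

Lemma locally_const_segment (f : C -> R) (x y : C) :
  (forall t, 0 <= t <= 1 ->
     locally (seg x y t) (fun z => f z = f (seg x y t))) -> f x = f y.
Proof.
intros H. rewrite <- (seg_0 x y) at 1. rewrite <- (seg_1 x y) at 2.
apply (locally_const_eq (fun t => f (seg x y t))).
intros t Ht. generalize (locally_seg _ _ _ _ (H t Ht)).
apply filter_imp. auto.
Qed.

Definition ball_in (a x : C) (r : R) : Prop := forall y, ball x r y -> V a y.

(** The intersection of two balls is convex, so the locally constant difference of the two
    potentials is constant on it. This makes [increment] independent of the ball and of the
    potential. *)
Lemma overlap_const (a b c1 c2 x y : C) (r1 r2 : R) :
  ball_in a c1 r1 -> ball_in b c2 r2 ->
  ball c1 r1 x -> ball c1 r1 y -> ball c2 r2 x -> ball c2 r2 y ->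
  p a y - p a x = p b y - p b x.
Proof.
intros Ha Hb H1 H2 H3 H4.
assert (E : p a x - p b x = p a y - p b y).
{ apply (locally_const_segment (fun z => p a z - p b z)).
  intros t Ht. apply V_compat; [apply Ha | apply Hb]; apply seg_ball; auto. }
lra.
Qed.

(* The increment of the sought primitive between two points that are close
   enough to lie in a common ball on which some local potential is defined. *)
Definition increment (x y : C) : R :=
  epsilon (inhabits 0) (fun v => exists a c r, ball_in a c r /\
    ball c r x /\ ball c r y /\ v = p a y - p a x).

Lemma increment_eq (a c x y : C) (r : R) :
  ball_in a c r -> ball c r x -> ball c r y -> increment x y = p a y - p a x.
Proof.
intros Hi Hx Hy. unfold increment.
match goal with |- epsilon ?i ?P = _ => assert (H : P (epsilon i P)) end.
{ apply epsilon_spec. exists (p a y - p a x), a, c, r. auto. }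
destruct H as (b & c2 & r2 & Hb & Hx2 & Hy2 & ->).
now apply (overlap_const b a c2 c x y r2 r).
Qed.

(** The Lebesgue number of the cover of the unit square by preimages of balls carrying a
    potential. *)
Lemma square_cover (K : R * R -> C) :
  (forall q, continuous K q) ->
  (forall s t, 0 <= s <= 1 -> 0 <= t <= 1 -> exists a, V a (K (s, t))) ->
  exists d, 0 < d /\ forall s t, 0 <= s <= 1 -> 0 <= t <= 1 ->
    exists a c r, ball_in a c r /\
      forall s' t', Rabs (s' - s) < d -> Rabs (t' - t) < d -> ball c r (K (s', t')).
Proof.
intros HK HV.
(* The ball is controlled on twice the gauge: a point within [d] of a point that is itself within
   the gauge of the centre is still covered. Outside the square the gauge takes the default value
   1. *)
assert (Hd : forall s t, exists d : posreal, 0 <= s <= 1 -> 0 <= t <= 1 ->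
  exists a r, ball_in a (K (s, t)) r /\
    forall s' t', Rabs (s' - s) < 2 * d -> Rabs (t' - t) < 2 * d ->
      ball (K (s, t)) r (K (s', t'))).
{ intros s t. destruct (classic (0 <= s <= 1 /\ 0 <= t <= 1)) as [[Hs Ht] | Hn].
  - destruct (HV s t Hs Ht) as [a Ha].
    destruct (V_open _ _ Ha) as [r Hr].
    destruct (HK (s, t) (ball (K (s, t)) r)) as [e He].
    { exists r. auto. }
    assert (He2 : 0 < e / 2) by (generalize (cond_pos e); lra).
    exists (mkposreal _ He2). intros _ _. exists a, r. split; [exact Hr |].
    simpl. intros s' t' H1 H2. apply He. split; simpl.
    + change (Rabs (s' - s) < e). lra.
    + change (Rabs (t' - t) < e). lra.
  - exists (mkposreal 1 Rlt_0_1). intros Hs Ht. tauto. }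
set (D := fun s t => proj1_sig (constructive_indefinite_description _ (Hd s t))).
assert (HD := fun s t => proj2_sig (constructive_indefinite_description _ (Hd s t))).
fold D in HD. cbv beta in HD.
destruct (compactness_value_2d 0 1 0 1 D) as [d Hcomp].
exists d. split; [apply cond_pos |]. intros s t Hs Ht.
destruct (NNPP _ (Hcomp s t Hs Ht)) as (u & v & Hu & Hv & H1 & H2 & H3).
destruct (HD u v Hu Hv) as (a & r & Hi & Hb).
exists a, (K (u, v)), r. split; [exact Hi |].
intros s' t' Hs' Ht'.
change (proj1_sig (constructive_indefinite_description _ (Hd u v))) with (D u v) in Hb.
apply Hb.
- replace (s' - u) with ((s' - s) + (s - u)) by ring.
  apply Rle_lt_trans with (1 := Rabs_triang _ _). lra.
- replace (t' - v) with ((t' - t) + (t - v)) by ring.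
  apply Rle_lt_trans with (1 := Rabs_triang _ _). lra.
Qed.

Definition node (n i : nat) : R := INR i / INR n.

Lemma node_bounds (n i : nat) : (0 < n)%nat -> (i <= n)%nat -> 0 <= node n i <= 1.
Proof.
intros Hn Hi. apply lt_INR in Hn. apply le_INR in Hi. simpl in Hn.
generalize (pos_INR i); intro. unfold node. split.
- apply Rdiv_le_0_compat; lra.
- apply Rmult_le_reg_r with (INR n); [lra |]. unfold Rdiv. field_simplify; lra.
Qed.

Lemma node_0 (n : nat) : node n 0 = 0.
Proof. unfold node. simpl. unfold Rdiv. ring. Qed.

Lemma node_n (n : nat) : (0 < n)%nat -> node n n = 1.
Proof. intro Hn. apply lt_INR in Hn. simpl in Hn. unfold node. field. lra. Qed.

Lemma node_S (n i : nat) : (0 < n)%nat -> node n (S i) - node n i = / INR n.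
Proof.
intro Hn. apply lt_INR in Hn. simpl in Hn. unfold node. rewrite S_INR. field. lra.
Qed.

Lemma eventually_fine (d : R) : 0 < d ->
  exists N, forall n, (N <= n)%nat -> (0 < n)%nat /\ / INR n < d.
Proof.
intros Hd. destruct (archimed_cor1 d Hd) as (N & HN & HN0).
exists N. intros n Hn. split; [lia |].
apply Rle_lt_trans with (2 := HN). apply Rinv_le_contravar.
- apply (lt_INR 0). exact HN0.
- apply le_INR. exact Hn.
Qed.

Definition path_sum (g : R -> C) (n : nat) : R :=
  rsum (fun i => increment (g (node n i)) (g (node n (S i)))) n.

Definition in_V (x : C) : Prop := exists a, V a x.

Definition path (g : R -> C) : Prop :=
  (forall t, continuous g t) /\ (forall t, 0 <= t <= 1 -> in_V (g t)).

Lemma path_cover (g : R -> C) : path g ->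
  exists d, 0 < d /\ forall t, 0 <= t <= 1 -> exists a c r, ball_in a c r /\
    forall t', Rabs (t' - t) < d -> ball c r (g t').
Proof.
intros [Hc Hg].
destruct (square_cover (fun q => g (snd q))) as (d & Hd & H).
- intros [s t]. apply (continuous_comp (fun q : R * R => snd q) g).
  + apply continuous_snd.
  + apply Hc.
- intros s t _ Ht. apply Hg. exact Ht.
- exists d. split; [exact Hd |]. intros t Ht.
  destruct (H 0 t) as (a & c & r & Hi & Hb); [lra | lra |].
  exists a, c, r. split; [exact Hi |]. intros t' Ht'.
  apply (Hb 0 t'); [| exact Ht']. rewrite Rminus_diag, Rabs_R0. exact Hd.
Qed.

(** Once the mesh is below the Lebesgue number, a step and its two halves lie in one ball, where
    increments are differences of a single potential and hence additive. *)
Lemma path_sum_double (g : R -> C) : path g ->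
  exists N, forall n, (N <= n)%nat -> path_sum g (2 * n) = path_sum g n.
Proof.
intros Hg. destruct (path_cover g Hg) as (d & Hd & H).
destruct (eventually_fine d Hd) as (N & HN).
exists N. intros n Hn. destruct (HN n Hn) as [Hn0 Hnd].
unfold path_sum. rewrite rsum_double. apply rsum_ext. intros i Hi.
assert (Hpos : 0 < INR n) by (apply (lt_INR 0); exact Hn0).
assert (E0 : node (2 * n) (2 * i) = node n i).
{ unfold node. rewrite !mult_INR. simpl. field. lra. }
assert (E2 : node (2 * n) (S (S (2 * i))) = node n (S i)).
{ unfold node. rewrite !S_INR, !mult_INR. simpl. field. lra. }
assert (E1 : node (2 * n) (S (2 * i)) - node n i = / INR n / 2).
{ unfold node. rewrite !S_INR, !mult_INR. simpl. field. lra. }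
rewrite E0, E2.
assert (Hinv : 0 < / INR n) by (apply Rinv_0_lt_compat; exact Hpos).
destruct (H (node n i)) as (a & c & r & Hin & Hb).
{ apply node_bounds; lia. }
assert (B0 : ball c r (g (node n i))).
{ apply Hb. rewrite Rminus_diag, Rabs_R0. exact Hd. }
assert (B1 : ball c r (g (node (2 * n) (S (2 * i))))).
{ apply Hb. rewrite E1, Rabs_pos_eq; lra. }
assert (B2 : ball c r (g (node n (S i)))).
{ apply Hb. rewrite node_S, Rabs_pos_eq; auto; lra. }
rewrite (increment_eq a c _ _ r Hin B0 B1), (increment_eq a c _ _ r Hin B1 B2),
  (increment_eq a c _ _ r Hin B0 B2). ring.
Qed.

(** Only subdivisions into [2 ^ k] steps are compared, so invariance under halving suffices, and
    concatenation turns [2 ^ k] steps on each path into [2 ^ (S k)] steps. *)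
Definition path_val (g : R -> C) (v : R) : Prop :=
  exists N, forall k, (N <= k)%nat -> path_sum g (2 ^ k) = v.

Lemma pow2_ge (k : nat) : (k <= 2 ^ k)%nat.
Proof. apply Nat.lt_le_incl, Nat.pow_gt_lin_r. lia. Qed.

Lemma path_val_exists (g : R -> C) : path g -> exists v, path_val g v.
Proof.
intros Hg. destruct (path_sum_double g Hg) as [N HN].
exists (path_sum g (2 ^ N)), N. intros k Hk.
induction Hk as [| k Hk IH]; [reflexivity |].
rewrite Nat.pow_succ_r', HN; [exact IH |].
apply Nat.le_trans with (1 := Hk), pow2_ge.
Qed.

Lemma path_val_unique (g : R -> C) (v w : R) : path_val g v -> path_val g w -> v = w.
Proof.
intros [N HN] [M HM]. rewrite <- (HN (N + M)%nat), <- (HM (N + M)%nat) by lia.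
reflexivity.
Qed.

(** On each half of [0, 1] one of the first two terms equals the common point [g1 1 = g2 0], which
    the last term removes. Continuity then needs no gluing at [/ 2]. *)
Definition concat_path (g1 g2 : R -> C) (t : R) : C :=
  (g1 (Rmin (2 * t) 1) + g2 (Rmax (2 * t - 1) 0) - g1 1)%C.

Lemma concat_path_l (g1 g2 : R -> C) (t : R) : g1 1 = g2 0 -> t <= / 2 ->
  concat_path g1 g2 t = g1 (2 * t).
Proof.
intros E Ht. unfold concat_path. rewrite Rmin_left, Rmax_right, E by lra. ring.
Qed.

Lemma concat_path_r (g1 g2 : R -> C) (t : R) : g1 1 = g2 0 -> / 2 <= t ->
  concat_path g1 g2 t = g2 (2 * t - 1).
Proof.
intros E Ht. unfold concat_path. rewrite Rmin_right, Rmax_left, E by lra. ring.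
Qed.

Lemma continuous_lip2 (f : R -> R) (t : R) :
  (forall s t, Rabs (f s - f t) <= 2 * Rabs (s - t)) -> continuous f t.
Proof.
intros H P [e He].
assert (He2 : 0 < e / 2) by (generalize (cond_pos e); lra).
exists (mkposreal _ He2). intros s Hs. apply He.
change (Rabs (s - t) < e / 2) in Hs. change (Rabs (f s - f t) < e).
generalize (H s t). lra.
Qed.

Lemma concat_path_path (g1 g2 : R -> C) : path g1 -> path g2 -> g1 1 = g2 0 ->
  path (concat_path g1 g2).
Proof.
intros [C1 V1] [C2 V2] E. split.
- intros t. unfold concat_path.
  assert (A1 : continuous (fun t => g1 (Rmin (2 * t) 1)) t).
  { apply (continuous_comp (fun t => Rmin (2 * t) 1) g1); [| apply C1].
    apply continuous_lip2. intros. unfold Rmin.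
    repeat destruct Rle_dec; unfold Rabs; repeat destruct Rcase_abs; lra. }
  assert (A2 : continuous (fun t => g2 (Rmax (2 * t - 1) 0)) t).
  { apply (continuous_comp (fun t => Rmax (2 * t - 1) 0) g2); [| apply C2].
    apply continuous_lip2. intros. unfold Rmax.
    repeat destruct Rle_dec; unfold Rabs; repeat destruct Rcase_abs; lra. }
  apply (continuous_minus (V := C_R_NormedModule)
    (fun t => (g1 (Rmin (2 * t) 1) + g2 (Rmax (2 * t - 1) 0))%C)
    (fun _ => g1 1)).
  + apply (continuous_plus (V := C_R_NormedModule)); assumption.
  + apply continuous_const.
- intros t Ht. destruct (Rle_dec t (/ 2)).
  + rewrite concat_path_l by auto. apply V1. lra.
  + rewrite concat_path_r by (auto; lra). apply V2. lra.
Qed.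

Lemma concat_path_val (g1 g2 : R -> C) (v1 v2 : R) : g1 1 = g2 0 ->
  path_val g1 v1 -> path_val g2 v2 -> path_val (concat_path g1 g2) (v1 + v2).
Proof.
intros E [N1 H1] [N2 H2]. exists (S (N1 + N2)). intros k Hk.
destruct k as [| k]; [lia |].
rewrite <- (H1 k), <- (H2 k) by lia.
set (n := (2 ^ k)%nat). assert (Hn : (0 < n)%nat).
{ unfold n. generalize (Nat.pow_nonzero 2 k). lia. }
assert (Hpos : 0 < INR n) by (apply (lt_INR 0); exact Hn).
rewrite Nat.pow_succ_r'. fold n. unfold path_sum.
replace (2 * n)%nat with (n + n)%nat by lia.
rewrite rsum_add. f_equal; apply rsum_ext; intros i Hi.
- assert (A : forall j, (j <= n)%nat ->
    concat_path g1 g2 (node (n + n) j) = g1 (node n j)).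
  { intros j Hj. apply le_INR in Hj.
    assert (Ej : 2 * node (n + n) j = node n j).
    { unfold node. rewrite plus_INR. field. lra. }
    rewrite concat_path_l; [now rewrite Ej | exact E |].
    apply Rmult_le_reg_l with 2; [lra |]. rewrite Ej.
    unfold node. apply Rmult_le_reg_r with (INR n); [lra |]. field_simplify; lra. }
  rewrite !A by lia. reflexivity.
- assert (A : forall j, concat_path g1 g2 (node (n + n) (n + j)) = g2 (node n j)).
  { intros j. generalize (pos_INR j); intro Hj.
    assert (Ej : 2 * node (n + n) (n + j) - 1 = node n j).
    { unfold node. rewrite !plus_INR. field. lra. }
    rewrite concat_path_r; [now rewrite Ej | exact E |].
    assert (0 <= node n j) by (apply Rdiv_le_0_compat; lra). lra. }
  replace (S (n + i)) with (n + S i)%nat by lia. rewrite !A. reflexivity.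
Qed.

Lemma increment_refl (x : C) : in_V x -> increment x x = 0.
Proof.
intros [a Ha]. destruct (V_open _ _ Ha) as [r Hr].
rewrite (increment_eq a x x x r Hr); try apply ball_center. ring.
Qed.

(* Over each small square of the grid the increments along the boundary add up
   to zero. *)
Lemma homotopy_path_val (K : R * R -> C) :
  (forall q, continuous K q) ->
  (forall s t, 0 <= s <= 1 -> 0 <= t <= 1 -> in_V (K (s, t))) ->
  (forall t, 0 <= t <= 1 -> K (1, t) = K (0, 0)) ->
  (forall s, 0 <= s <= 1 -> K (s, 0) = K (s, 1)) ->
  path_val (fun t => K (0, t)) 0.
Proof.
intros HK HV K1 Ks.
destruct (square_cover K HK HV) as (d & Hd & H).
destruct (eventually_fine d Hd) as (N & HN).
exists N. intros k Hk.
assert (HkN : (N <= 2 ^ k)%nat) by (generalize (pow2_ge k); lia).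
destruct (HN _ HkN) as [Hn Hnd]. revert Hn Hnd. generalize (2 ^ k)%nat as n.
clear k Hk HkN. intros n Hn Hnd.
set (P := fun i j => K (node n i, node n j)).
set (row := fun i m => rsum (fun j => increment (P i j) (P i (S j))) m).
assert (Hinv : 0 < / INR n) by (apply Rinv_0_lt_compat, (lt_INR 0); exact Hn).
assert (Hsq : forall i m, (i < n)%nat -> (m <= n)%nat ->
  row i m - row (S i) m = increment (P i O) (P (S i) O) - increment (P i m) (P (S i) m)).
{ intros i m Hi. induction m as [| m IH]; intros Hm; unfold row in *; cbn [rsum]; [ring |].
  specialize (IH ltac:(lia)).
  destruct (H (node n i) (node n m)) as (a & c & r & Hin & Hb);
    try (apply node_bounds; lia).
  assert (B : forall i' m', (i' = i \/ i' = S i) -> (m' = m \/ m' = S m) ->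
    ball c r (P i' m')).
  { assert (Q : forall u v, (v = u \/ v = S u) -> Rabs (node n v - node n u) < d).
    { intros u v [-> | ->].
      - rewrite Rminus_diag, Rabs_R0. exact Hd.
      - rewrite node_S, Rabs_pos_eq; auto; lra. }
    intros i' m' H1 H2. apply Hb; apply Q; assumption. }
  rewrite (increment_eq a c (P i m) (P i (S m)) r),
    (increment_eq a c (P (S i) m) (P (S i) (S m)) r),
    (increment_eq a c (P i (S m)) (P (S i) (S m)) r) by auto.
  rewrite (increment_eq a c (P i m) (P (S i) m) r) in IH by auto. lra. }
(* By [Ks] the first and the last columns of the grid carry the same points, so their vertical
   increments cancel. *)
assert (Hrow : forall i, (i <= n)%nat -> row i n = row O n).
{ induction i as [| i IH]; intros Hi; [reflexivity |].
  rewrite <- IH by lia. generalize (Hsq i n ltac:(lia) ltac:(lia)).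
  unfold P. rewrite node_0, node_n, !Ks by (try apply node_bounds; lia). lra. }
(* The last row is a constant path. *)
assert (Hend : row n n = 0).
{ unfold row.
  assert (Z : forall m, (m <= n)%nat ->
    rsum (fun j => increment (P n j) (P n (S j))) m = 0).
  { induction m as [| m IH]; intros Hm; simpl; [reflexivity |].
    rewrite IH by lia. unfold P. rewrite node_n by lia.
    rewrite !K1 by (apply node_bounds; lia).
    rewrite increment_refl; [ring |]. apply HV; lra. }
  apply Z. lia. }
rewrite Hrow in Hend by lia. transitivity (row O n); [| exact Hend].
unfold path_sum, row, P. rewrite node_0. reflexivity.
Qed.

Variable D : C -> Prop.
Hypothesis D_sc : simply_connected D.
Hypothesis D_V : forall x, D x <-> in_V x.

Lemma loop_val (g : R -> C) : path g -> g 0 = g 1 -> path_val g 0.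
Proof.
intros [Hc HV] E.
destruct (proj2 D_sc g Hc) as (K & KC & KD & K0 & K1 & Ks).
- intros t Ht. apply D_V, HV, Ht.
- exact E.
- destruct (homotopy_path_val K KC) as [N HN].
  + intros. apply D_V. auto.
  + intros t Ht. rewrite K1, K0 by lra. reflexivity.
  + intros s Hs. destruct (Ks s Hs) as [-> ->]. reflexivity.
  (* The homotopy starts at [g] only for parameters in [0, 1], but the sums see nothing else. *)
  + exists N. intros k Hk. rewrite <- (HN k Hk).
    assert (Hn : (0 < 2 ^ k)%nat) by (generalize (Nat.pow_nonzero 2 k); lia).
    apply rsum_ext. intros i Hi. rewrite !K0 by (apply node_bounds; lia).
    reflexivity.
Qed.

Lemma path_between (x y : C) : D x -> D y ->
  exists g, path g /\ g 0 = x /\ g 1 = y.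
Proof.
intros Hx Hy. destruct (proj1 D_sc x y Hx Hy) as (g & Hc & Hg & H0 & H1).
exists g. split; [split; [exact Hc |] | auto].
intros t Ht. apply D_V, Hg, Ht.
Qed.

Lemma seg_path (a c x y : C) (r : R) :
  ball_in a c r -> ball c r x -> ball c r y ->
  path (seg x y) /\ path_val (seg x y) (p a y - p a x).
Proof.
intros Hi Hx Hy. split; [split |].
- intros t. apply seg_continuous.
- intros t Ht. exists a. apply Hi, seg_ball; auto.
- exists O. intros k _.
  assert (Hn : (0 < 2 ^ k)%nat) by (generalize (Nat.pow_nonzero 2 k); lia).
  revert Hn. generalize (2 ^ k)%nat as n. intros n Hn. unfold path_sum.
  rewrite rsum_ext with (g := fun i => p a (seg x y (node n (S i))) - p a (seg x y (node n i))).
  + rewrite (rsum_telescope (fun i => p a (seg x y (node n i)))).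
    rewrite node_n, node_0, seg_0, seg_1 by auto. reflexivity.
  + intros i Hin. apply (increment_eq a c _ _ r); auto;
      apply seg_ball; auto; apply node_bounds; lia.
Qed.

(** [h x] is the value of some path from a base point to [x]; that loops have value 0 makes the
    choice of the path irrelevant. *)
Lemma primitive_exists :
  exists h : C -> R, forall a x, V a x ->
    locally x (fun y => h y - p a y = h x - p a x).
Proof.
destruct (classic (exists x0, D x0)) as [[x0 H0] | Hn].
2: { exists (fun _ => 0). intros a x Hx. exfalso. apply Hn. exists x.
  apply D_V. exists a. exact Hx. }
set (R0 := fun x v => exists g, path g /\ g 0 = x0 /\ g 1 = x /\ path_val g v).
assert (Hex : forall x, D x -> exists v, R0 x v).
{ intros x Hx. destruct (path_between x0 x H0 Hx) as (g & Hg & E0 & E1).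
  destruct (path_val_exists g Hg) as [v Hv]. exists v, g. auto. }
set (h := fun x => epsilon (inhabits 0) (R0 x)).
assert (Hh : forall x, D x -> R0 x (h x)).
{ intros x Hx. unfold h. apply epsilon_spec. auto. }
exists h. intros a x Hx. destruct (V_open _ _ Hx) as [r Hr].
exists r. intros y Hy.
destruct (Hh x) as (g1 & P1 & A1 & B1 & W1); [apply D_V; exists a; exact Hx |].
assert (Dy : D y) by (apply D_V; exists a; apply Hr; exact Hy).
destruct (Hh y Dy) as (g2 & P2 & A2 & B2 & W2).
(* The same return path closes both the path chosen for [y] and the path chosen for [x] followed by
   a segment; subtracting the two loop identities avoids reversing paths. *)
destruct (path_between y x0 Dy H0) as (g3 & P3 & A3 & B3).
destruct (path_val_exists g3 P3) as [v3 W3].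
destruct (seg_path a x x y r Hr) as [P4 W4]; [apply ball_center | exact Hy |].
assert (E1 : h y + v3 = 0).
{ assert (E : g2 1 = g3 0) by congruence.
  apply (path_val_unique (concat_path g2 g3)); [apply concat_path_val; auto |].
  apply loop_val; [apply concat_path_path; auto |].
  rewrite concat_path_l, concat_path_r by (auto; lra).
  replace (2 * 0) with 0 by ring. replace (2 * 1 - 1) with 1 by ring. congruence. }
assert (E2 : h x + (p a y - p a x) + v3 = 0).
{ assert (E : g1 1 = seg x y 0) by (rewrite seg_0; exact B1).
  assert (E' : concat_path g1 (seg x y) 1 = g3 0).
  { rewrite concat_path_r by (auto; lra). replace (2 * 1 - 1) with 1 by ring.
    rewrite seg_1. congruence. }
  apply (path_val_unique (concat_path (concat_path g1 (seg x y)) g3)).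
  - apply concat_path_val; auto. apply concat_path_val; auto.
  - apply loop_val; [apply concat_path_path; auto; apply concat_path_path; auto |].
    rewrite (concat_path_r _ _ 1), (concat_path_l _ g3 0) by (auto; lra).
    replace (2 * 0) with 0 by ring. replace (2 * 1 - 1) with 1 by ring.
    rewrite concat_path_l by (auto; lra). replace (2 * 0) with 0 by ring. congruence. }
lra.
Qed.

End Potential.

(** * Affine and polar coordinates *)

Ltac C_field := apply injective_projections; simpl; try field; try ring.

Lemma cross_eq (a b : C) : cross a b = fst a * snd b - snd a * fst b.
Proof. unfold cross. simpl. ring. Qed.

Definition affine_pt (a b d : C) (s t : R) : C :=
  (a + RtoC s * (b - a) + RtoC t * (d - a))%C.

Definition frame_det (a b d : C) : R := cross (b - a) (d - a).

(** Cramer's rule in the frame with origin [a] and basis [b - a], [d - a]. *)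
Definition coord1 (a b d x : C) : R := cross (x - a) (d - a) / frame_det a b d.
Definition coord2 (a b d x : C) : R := cross (b - a) (x - a) / frame_det a b d.

Lemma affine_pt_coords (a b d x : C) : frame_det a b d <> 0 ->
  affine_pt a b d (coord1 a b d x) (coord2 a b d x) = x.
Proof.
unfold affine_pt, coord1, coord2, frame_det. rewrite !cross_eq. simpl. intro H.
apply injective_projections; simpl; field; exact H.
Qed.

Lemma coord1_affine_pt (a b d : C) (s t : R) : frame_det a b d <> 0 ->
  coord1 a b d (affine_pt a b d s t) = s.
Proof.
unfold affine_pt, coord1, frame_det. rewrite !cross_eq. simpl. intro H. field. exact H.
Qed.

Lemma coord2_affine_pt (a b d : C) (s t : R) : frame_det a b d <> 0 ->
  coord2 a b d (affine_pt a b d s t) = t.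
Proof.
unfold affine_pt, coord2, frame_det. rewrite !cross_eq. simpl. intro H. field. exact H.
Qed.

Lemma affine_pt_inj (a b d : C) (s t s' t' : R) : frame_det a b d <> 0 ->
  affine_pt a b d s t = affine_pt a b d s' t' -> s = s' /\ t = t'.
Proof.
intros H E. split.
- rewrite <- (coord1_affine_pt a b d s t H), E. now apply coord1_affine_pt.
- rewrite <- (coord2_affine_pt a b d s t H), E. now apply coord2_affine_pt.
Qed.

Lemma locally_linear (A B e : R) (x : C) : 0 < e ->
  locally x (fun y : C => Rabs (A * (fst y - fst x) + B * (snd y - snd x)) < e).
Proof.
intros He.
assert (PA := Rabs_pos A). assert (PB := Rabs_pos B).
set (M := 1 + Rabs A + Rabs B).
assert (HM : 0 < M) by (unfold M; lra).
assert (Hd : 0 < e / M) by (apply Rdiv_lt_0_compat; assumption).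
exists (mkposreal _ Hd). intros y Hy. apply ball_C_iff in Hy. simpl in Hy.
destruct Hy as [H1 H2].
apply Rle_lt_trans with (1 := Rabs_triang _ _). rewrite !Rabs_mult.
assert (Rabs A * Rabs (fst y - fst x) <= Rabs A * (e / M)).
{ apply Rmult_le_compat_l; [assumption | apply Rlt_le; assumption]. }
assert (Rabs B * Rabs (snd y - snd x) <= Rabs B * (e / M)).
{ apply Rmult_le_compat_l; [assumption | apply Rlt_le; assumption]. }
assert (E : e = e / M + Rabs A * (e / M) + Rabs B * (e / M)).
{ transitivity (e / M * M); [field; lra | unfold M at 2; ring]. }
lra.
Qed.

Lemma locally_coords (a b d x : C) (s t e : R) : frame_det a b d <> 0 -> 0 < e ->
  x = affine_pt a b d s t ->
  locally x (fun y => exists s' t', y = affine_pt a b d s' t' /\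
    Rabs (s' - s) < e /\ Rabs (t' - t) < e).
Proof.
intros H He ->.
generalize (filter_and _ _
  (locally_linear (snd (d - a)%C / frame_det a b d) (- fst (d - a)%C / frame_det a b d)
    e (affine_pt a b d s t) He)
  (locally_linear (- snd (b - a)%C / frame_det a b d) (fst (b - a)%C / frame_det a b d)
    e (affine_pt a b d s t) He)).
apply filter_imp. intros y [H1 H2].
exists (coord1 a b d y), (coord2 a b d y). split; [symmetry; now apply affine_pt_coords |].
split.
- apply Rle_lt_trans with (2 := H1). right. f_equal.
  rewrite <- (coord1_affine_pt a b d s t H) at 1.
  unfold coord1. rewrite !cross_eq. simpl. field. exact H.
- apply Rle_lt_trans with (2 := H2). right. f_equal.
  rewrite <- (coord2_affine_pt a b d s t H) at 1.
  unfold coord2. rewrite !cross_eq. simpl. field. exact H.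
Qed.

Lemma Rabs_lt_bounds (x e : R) : Rabs x < e -> - e < x < e.
Proof. intro H. apply Rabs_def2 in H. lra. Qed.

Lemma open_rhombus_open (a b d x : C) : frame_det a b d <> 0 ->
  open_rhombus a b d x -> locally x (open_rhombus a b d).
Proof.
intros H (s & t & Hs & Ht & E).
set (e := Rmin (Rmin s (1 - s)) (Rmin t (1 - t))).
assert (He : 0 < e) by (unfold e; repeat apply Rmin_glb_lt; lra).
assert (e <= s /\ e <= 1 - s /\ e <= t /\ e <= 1 - t) as (E1 & E2 & E3 & E4).
{ unfold e. generalize (Rmin_l (Rmin s (1 - s)) (Rmin t (1 - t)))
    (Rmin_r (Rmin s (1 - s)) (Rmin t (1 - t)))
    (Rmin_l s (1 - s)) (Rmin_r s (1 - s)) (Rmin_l t (1 - t)) (Rmin_r t (1 - t)). lra. }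
generalize (locally_coords a b d x s t e H He E). apply filter_imp.
intros y (s' & t' & -> & H1 & H2). apply Rabs_lt_bounds in H1, H2.
exists s', t'. repeat split; lra.
Qed.

Lemma open_triangle_open (a b d x : C) : frame_det a b d <> 0 ->
  open_triangle a b d x -> locally x (open_triangle a b d).
Proof.
intros H (s & t & Hs & Ht & Hst & E).
set (e := Rmin (Rmin s t) ((1 - s - t) / 2)).
assert (He : 0 < e) by (unfold e; repeat apply Rmin_glb_lt; lra).
assert (e <= s /\ e <= t /\ 2 * e <= 1 - s - t) as (E1 & E2 & E3).
{ unfold e. generalize (Rmin_l (Rmin s t) ((1 - s - t) / 2))
    (Rmin_r (Rmin s t) ((1 - s - t) / 2)) (Rmin_l s t) (Rmin_r s t). lra. }
generalize (locally_coords a b d x s t e H He E). apply filter_imp.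
intros y (s' & t' & -> & H1 & H2). apply Rabs_lt_bounds in H1, H2.
exists s', t'. repeat split; lra.
Qed.

Lemma open_triangle_rhombus (a b d x : C) : open_triangle a b d x -> open_rhombus a b d x.
Proof. intros (s & t & ? & ? & ? & ->). exists s, t. repeat split; lra. Qed.

Lemma closed_triangle_rhombus (a b d x : C) :
  closed_triangle a b d x -> closed_rhombus a b d x.
Proof. intros (s & t & ? & ? & ? & ->). exists s, t. repeat split; lra. Qed.

Lemma open_closed_rhombus (a b d x : C) : open_rhombus a b d x -> closed_rhombus a b d x.
Proof. intros (s & t & ? & ? & ->). exists s, t. repeat split; lra. Qed.

(** Used to push a point off sides and diagonals into open cells without leaving a given
    neighbourhood. *)
Lemma locally_direction (x v : C) (P : C -> Prop) : locally x P ->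
  exists e, 0 < e /\ forall r, 0 <= r < e -> P (x + RtoC r * v)%C.
Proof.
intros H.
assert (H' : locally 0 (fun r => P (seg x (x + v)%C r))).
{ apply locally_seg. now rewrite seg_0. }
destruct H' as [e He]. exists e. split; [apply cond_pos |].
intros r Hr. replace (x + RtoC r * v)%C with (seg x (x + v)%C r).
- apply He. change (Rabs (r - 0) < e). rewrite Rminus_0_r, Rabs_pos_eq; lra.
- unfold seg. ring.
Qed.

Lemma expi_add_2PI (x : R) (n : nat) : expi (x + 2 * PI * INR n) = expi x.
Proof.
unfold expi. f_equal.
- replace (x + 2 * PI * INR n) with (x + 2 * INR n * PI) by ring. apply cos_period.
- replace (x + 2 * PI * INR n) with (x + 2 * INR n * PI) by ring. apply sin_period.
Qed.

Lemma unit_polar (c s : R) : c * c + s * s = 1 -> exists f, c = cos f /\ s = sin f.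
Proof.
intros H. assert (Hc : -1 <= c <= 1) by nra.
destruct (Rle_dec 0 s) as [Hs | Hs].
- exists (acos c). rewrite cos_acos by exact Hc. split; [reflexivity |].
  rewrite sin_acos by exact Hc. replace (1 - c²) with (s²) by (unfold Rsqr; lra).
  rewrite sqrt_Rsqr; [reflexivity | exact Hs].
- exists (- acos c). rewrite cos_neg, sin_neg, cos_acos by exact Hc. split; [reflexivity |].
  rewrite sin_acos by exact Hc. replace (1 - c²) with ((- s)²) by (unfold Rsqr; lra).
  rewrite sqrt_Rsqr; lra.
Qed.

Lemma Cmod_expi (x : R) : Cmod (expi x) = 1.
Proof.
unfold Cmod, expi. simpl. transitivity (sqrt 1); [f_equal | apply sqrt_1].
generalize (sin2_cos2 x). unfold Rsqr. lra.
Qed.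

Lemma angle_shift (f al : R) : exists g, al <= g < al + 2 * PI /\ expi g = expi f.
Proof.
assert (HP := PI_RGT_0).
set (k := Int_part ((f - al) / (2 * PI))).
destruct (base_Int_part ((f - al) / (2 * PI))) as [H1 H2]. fold k in H1, H2.
assert (E : (f - al) / (2 * PI) * (2 * PI) = f - al) by (field; lra).
exists (f - IZR k * (2 * PI)). split; [nra |].
unfold expi. destruct (Z_le_gt_dec 0%Z k) as [Hk | Hk].
- rewrite <- (Z2Nat.id k Hk) at 1 2. rewrite <- !INR_IZR_INZ.
  rewrite <- (cos_period (f - INR (Z.to_nat k) * (2 * PI)) (Z.to_nat k)) at 1.
  rewrite <- (sin_period (f - INR (Z.to_nat k) * (2 * PI)) (Z.to_nat k)) at 1.
  f_equal; f_equal; ring.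
- replace (IZR k) with (- INR (Z.to_nat (- k))).
  + rewrite <- (cos_period f (Z.to_nat (- k))), <- (sin_period f (Z.to_nat (- k))).
    f_equal; f_equal; ring.
  + rewrite INR_IZR_INZ, Z2Nat.id by lia. rewrite opp_IZR. ring.
Qed.

Lemma polar (X : C) (al : R) : X <> 0%C -> exists f, al <= f < al + 2 * PI /\
  X = (RtoC (Cmod X) * expi f)%C.
Proof.
intros HX. assert (Hm := proj1 (Cmod_gt_0 X) HX).
assert (E : Cmod X * Cmod X = fst X * fst X + snd X * snd X).
{ unfold Cmod. rewrite sqrt_sqrt; [ring | nra]. }
destruct (unit_polar (fst X / Cmod X) (snd X / Cmod X)) as (f & Hc & Hs).
{ apply Rmult_eq_reg_r with (Cmod X * Cmod X); [| nra]. rewrite E at 2. field. lra. }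
destruct (angle_shift f al) as (g & Hg & Eg). exists g. split; [exact Hg |].
rewrite Eg. unfold expi. rewrite <- Hc, <- Hs.
apply injective_projections; simpl; field; lra.
Qed.

Lemma expi_inj (x y : R) : expi x = expi y -> -2 * PI < x - y < 2 * PI -> x = y.
Proof.
intros E H. injection E as E1 E2.
assert (Hc : cos (x - y) = 1).
{ rewrite cos_minus, E1, E2. generalize (sin2_cos2 y). unfold Rsqr. lra. }
assert (Hs : sin ((x - y) / 2) = 0).
{ replace (x - y) with (2 * ((x - y) / 2)) in Hc by field.
  rewrite cos_2a_sin in Hc. nra. }
destruct (Rtotal_order x y) as [Hl | [-> | Hl]]; [| reflexivity |].
- assert (0 < sin ((y - x) / 2)) by (apply sin_gt_0; lra).
  replace ((y - x) / 2) with (- ((x - y) / 2)) in H0 by field.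
  rewrite sin_neg in H0. lra.
- assert (0 < sin ((x - y) / 2)) by (apply sin_gt_0; lra). lra.
Qed.

Definition rotation (a b c d a' b' c' d' : C) : Prop :=
  (a' = a /\ b' = b /\ c' = c /\ d' = d) \/
  (a' = b /\ b' = c /\ c' = d /\ d' = a) \/
  (a' = c /\ b' = d /\ c' = a /\ d' = b) \/
  (a' = d /\ b' = a /\ c' = b /\ d' = c).

Lemma rotation_sym (a b c d a' b' c' d' : C) :
  rotation a b c d a' b' c' d' -> rotation a' b' c' d' a b c d.
Proof.
unfold rotation. intros [H | [H | [H | H]]]; destruct H as (-> & -> & -> & ->); tauto.
Qed.

Lemma rotation_trans (a b c d a' b' c' d' a'' b'' c'' d'' : C) :
  rotation a b c d a' b' c' d' -> rotation a' b' c' d' a'' b'' c'' d'' ->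
  rotation a b c d a'' b'' c'' d''.
Proof.
unfold rotation. intros [H | [H | [H | H]]] [K | [K | [K | K]]];
  destruct H as (-> & -> & -> & ->); destruct K as (-> & -> & -> & ->); tauto.
Qed.

(** * Projections and the quadratic form of the Laplacian *)

(** The real part of F e^(if), that is, the coordinate of F along e^(-if), a square root of the
    inverse of e^(2if). Unlike the projection itself it depends on the lift [f], and it changes sign
    under f -> f + pi. *)
Definition proj_coef (F : C) (f : R) : R := fst F * cos f - snd F * sin f.

Lemma Proj_expi (r f : R) (F : C) : 0 < r ->
  Proj F (inv_sqrt (RtoC r * expi (2 * f))) = (RtoC (proj_coef F f) * expi (- f))%C.
Proof.
intros Hr. assert (P : forall a, cos a * cos a + sin a * sin a = 1).
{ intro a. generalize (sin2_cos2 a). unfold Rsqr. lra. }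
assert (N : (RtoC r * expi (2 * f))%C <> 0%C).
{ intro E. assert (E1 := f_equal fst E). assert (E2 := f_equal snd E). simpl in E1, E2.
  specialize (P (2 * f)). nra. }
assert (S : (0 < / sqrt r)%R) by (apply Rinv_0_lt_compat, sqrt_lt_R0, Hr).
assert (Q : sqrt r * sqrt r = r) by (apply sqrt_sqrt; lra).
(* The principal branch is replaced by the explicit root e^(-if) / sqrt r. *)
rewrite <- (@Proj_inv_sqrt F _ (RtoC (/ sqrt r) * expi (- f))%C N).
- unfold Proj.
  assert (M : Cmod (RtoC (/ sqrt r) * expi (- f)) ^ 2 = / r).
  { rewrite Cmod_mult, Cmod_R, Rabs_pos_eq, Cmod_expi by lra. simpl.
    rewrite !Rmult_1_r, <- Rinv_mult, Q. reflexivity. }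
  rewrite M.
  assert (T : (RtoC (/ sqrt r) * expi (- f))%C = (/ sqrt r * cos f, - (/ sqrt r * sin f))).
  { unfold expi. rewrite cos_neg, sin_neg. apply injective_projections; simpl; ring. }
  set (W := (cos f * cos f - sin f * sin f, - (2 * sin f * cos f)) : C).
  assert (T2 : ((RtoC (/ sqrt r) * expi (- f)) ^ 2)%C =
    (RtoC (/ r) * W)%C).
  { unfold W. rewrite T. rewrite <- Q at 3. rewrite Rinv_mult.
    apply injective_projections; simpl; ring. }
  rewrite T2.
  replace (Cconj F * (RtoC (/ r) * W)
    / (2 * RtoC (/ r)))%C with
    (Cconj F * W / 2)%C.
  2: { field. intro E. injection E. generalize (Rinv_0_lt_compat r Hr). lra. }
  unfold W, proj_coef, expi. rewrite cos_neg, sin_neg. specialize (P f).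
  destruct F as [p q].
  apply injective_projections; simpl; field_simplify;
    replace (sin f ^ 2) with (1 - cos f ^ 2) by (rewrite <- P; ring); field.
- assert (E : (expi (- f) * expi (- f) * expi (2 * f))%C = 1%C).
  { unfold expi. rewrite cos_neg, sin_neg, cos_2a, sin_2a. specialize (P f).
    apply injective_projections; simpl.
    - transitivity ((cos f * cos f + sin f * sin f) * (cos f * cos f + sin f * sin f));
        [ring | rewrite P; ring].
    - ring. }
  assert (Z : (RtoC r * expi (2 * f) * ((RtoC (/ sqrt r) * expi (- f)) ^ 2))%C = 1%C).
  { transitivity (RtoC r * RtoC (/ sqrt r) * RtoC (/ sqrt r) *
      (expi (- f) * expi (- f) * expi (2 * f)))%C; [ring |].
    rewrite E, Cmult_1_r, <- !RtoC_mult. f_equal.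
    rewrite <- Q at 1. field. apply Rgt_not_eq, sqrt_lt_R0, Hr. }
  rewrite <- (Cmult_1_r (/ _)), <- Z. field.
  split; intro E0; apply N; rewrite E0; ring.
Qed.

(** With Z = r e^(2if) this is the double-angle identity 2 (Re G)^2 = |G|^2 + Re (G^2) for G = F
    e^(if). *)
Lemma Proj_norm (r : R) (F Z : C) : 0 < r -> Cmod Z = r ->
  2 * r * Cmod (Proj F (inv_sqrt Z)) ^ 2 = r * Cmod F ^ 2 + Re (F ^ 2 * Z)%C.
Proof.
intros Hr HZ.
assert (N : Z <> 0%C) by (intro E; rewrite E, Cmod_0 in HZ; lra).
destruct (polar Z 0 N) as (g & _ & E). rewrite HZ in E.
replace g with (2 * (g / 2)) in E by field. set (f := g / 2) in *.
rewrite E, Proj_expi by exact Hr.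
rewrite Cmod_mult, Cmod_R.
assert (P := sin2_cos2 f). unfold Rsqr in P.
rewrite Cmod_expi, Rmult_1_r, pow2_abs.
assert (MF : Cmod F ^ 2 = fst F * fst F + snd F * snd F).
{ unfold Cmod. rewrite <- Rsqr_pow2, Rsqr_sqrt; [ring | nra]. }
rewrite MF. unfold proj_coef, expi. rewrite cos_2a, sin_2a. simpl.
replace (r * (fst F * fst F + snd F * snd F)) with
  (r * (fst F * fst F + snd F * snd F) * (sin f * sin f + cos f * cos f))
  by (rewrite P; ring).
ring.
Qed.

Lemma Proj_coef_eq (r f : R) (F G : C) : 0 < r ->
  Proj F (inv_sqrt (RtoC r * expi (2 * f))) = Proj G (inv_sqrt (RtoC r * expi (2 * f))) ->
  proj_coef F f = proj_coef G f.
Proof.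
intros Hr. rewrite !Proj_expi by exact Hr. intro E.
assert (E1 := f_equal fst E). assert (E2 := f_equal snd E). unfold expi in E1, E2.
simpl in E1, E2. assert (P := sin2_cos2 (- f)). unfold Rsqr in P.
replace (proj_coef F f) with (proj_coef F f * (sin (- f) * sin (- f) + cos (- f) * cos (- f)))
  by (rewrite P; ring).
replace (proj_coef G f) with (proj_coef G f * (sin (- f) * sin (- f) + cos (- f) * cos (- f)))
  by (rewrite P; ring).
assert (E1' : proj_coef F f * cos (- f) = proj_coef G f * cos (- f)) by lra.
assert (E2' : proj_coef F f * sin (- f) = proj_coef G f * sin (- f)) by lra.
rewrite !Rmult_plus_distr_l, <- !Rmult_assoc, E1', E2'. reflexivity.
Qed.

(** For 0 < th < pi this is the minimum of the integral of f'^2 - f^2 over paths f from x to y in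
    time th, twice the action of the unit harmonic oscillator. Merging two steps thus amounts to
    dropping the constraint at the intermediate time. *)
Definition qform (th x y : R) : R := (cos th * (x * x + y * y) - 2 * x * y) / sin th.

(* [qform (s + t) x z] is the minimum over [y] of the left-hand side. *)
Lemma qform_merge (s t x y z : R) : 0 < s -> 0 < t -> s + t < PI ->
  qform (s + t) x z <= qform s x y + qform t y z.
Proof.
intros Hs Ht Hst.
assert (S1 : 0 < sin s) by (apply sin_gt_0; lra).
assert (S2 : 0 < sin t) by (apply sin_gt_0; lra).
assert (S3 : 0 < sin (s + t)) by (apply sin_gt_0; lra).
(* The excess is a square vanishing at y = (x sin t + z sin s) / sin (s + t), the position of the
   free oscillation from x to z at time s. *)
assert (E : qform s x y + qform t y z - qform (s + t) x z =
  Rsqr (y * sin (s + t) - (x * sin t + z * sin s)) / (sin s * sin t * sin (s + t))).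
{ unfold qform, Rsqr.
  assert (P1 := sin2_cos2 s). assert (P2 := sin2_cos2 t). unfold Rsqr in P1, P2.
  assert (N : sin t * sin (s + t) * (cos s * (x * x + y * y) - 2 * x * y) +
      sin s * sin (s + t) * (cos t * (y * y + z * z) - 2 * y * z) -
      sin s * sin t * (cos (s + t) * (x * x + z * z) - 2 * x * z) =
    (y * sin (s + t) - (x * sin t + z * sin s)) *
    (y * sin (s + t) - (x * sin t + z * sin s))).
  { transitivity ((y * sin (s + t)) * (y * sin (s + t)) -
      2 * y * sin (s + t) * (x * sin t + z * sin s) + 2 * x * z * sin s * sin t +
      x * x * (sin t * sin t) * (sin s * sin s + cos s * cos s) +
      z * z * (sin s * sin s) * (sin t * sin t + cos t * cos t)).
    - rewrite cos_plus, sin_plus. ring.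
    - rewrite P1, P2. ring. }
  rewrite <- N. field. repeat split; lra. }
assert (0 <= Rsqr (y * sin (s + t) - (x * sin t + z * sin s)) / (sin s * sin t * sin (s + t))).
{ apply Rdiv_le_0_compat; [apply Rle_0_sqr |]. repeat apply Rmult_lt_0_compat; assumption. }
lra.
Qed.

Lemma qform_close (t x y : R) : qform (PI - t) x y + qform t y (- x) = 0.
Proof.
unfold qform. rewrite sin_PI_x.
replace (cos (PI - t)) with (- cos t).
2: { rewrite cos_minus, cos_PI, sin_PI. ring. }
unfold Rdiv. ring.
Qed.

(** Merging requires a total angle below pi, so over a half-period every step but the last can be
    absorbed; the last one is then cancelled by [qform_close]. *)
Lemma qform_sum_ge (a x : nat -> R) (m : nat) :
  (forall k, a k < a (S k)) -> a (S m) - a O < PI ->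
  qform (a (S m) - a O) (x O) (x (S m)) <=
  sum_f_R0 (fun k => qform (a (S k) - a k) (x k) (x (S k))) m.
Proof.
intros Ha. assert (Hpos : forall k, a O < a (S k)).
{ induction k as [| k IH]; [apply Ha | generalize (Ha (S k)); lra]. }
induction m as [| m IH]; intros H; simpl; [right; reflexivity |].
assert (Hm := Ha (S m)). assert (IH' := IH ltac:(lra)).
assert (Hq := qform_merge (a (S m) - a O) (a (S (S m)) - a (S m))
  (x O) (x (S m)) (x (S (S m)))).
replace (a (S m) - a O + (a (S (S m)) - a (S m))) with (a (S (S m)) - a O) in Hq by ring.
specialize (Hpos m). specialize (Hq ltac:(lra) ltac:(lra) H). lra.
Qed.

Lemma qform_sum_nonneg (a x : nat -> R) (m : nat) :
  (forall k, 0 < a (S k) - a k < PI) -> a (S m) = a O + PI -> x (S m) = - x O ->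
  0 <= sum_f_R0 (fun k => qform (a (S k) - a k) (x k) (x (S k))) m.
Proof.
intros Ha Hend Hx. destruct m as [| m].
(* A single step would have length exactly pi, which the strict bound excludes. *)
- specialize (Ha O). lra.
- simpl. assert (Hm := Ha (S m)).
  assert (H := qform_sum_ge a x m ltac:(intro k; generalize (Ha k); lra) ltac:(lra)).
  assert (H0 := qform_close (a (S (S m)) - a (S m)) (x O) (x (S m))).
  rewrite <- Hx in H0.
  replace (PI - (a (S (S m)) - a (S m))) with (a (S m) - a O) in H0 by lra. lra.
Qed.

(** * The rhombic tiling *)

Section Lattice.

Variables (delta eta : R) (L : lattice).
Hypotheses (hdelta : 0 < delta) (heta : 0 < eta) (hL : isoradial delta L)
  (hangles : angles_bounded L eta).

Notation Lam := (Lam L).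
Notation nb := (nb delta L).
Notation opp := (opp delta L).
Notation center := (center delta L).
Notation rhombus := (rhombus delta L).
Notation arg := (arg L).
Notation deg := (deg L).

Ltac clash := exfalso; match goal with
  H : black L ?v, H' : white L ?v |- _ => exact (colour_disjoint hL (conj H H')) end.

Lemma Lam_nb (v : C) (k : nat) : Lam v -> Lam (nb v k).
Proof.
intros [H | H]; [right; now apply (black_nb hL) | left; now apply (white_nb hL)].
Qed.

Lemma deg_pos (v : C) : Lam v -> (0 < deg v)%nat.
Proof.
intro H. destruct (Nat.eq_0_gt_0_cases (deg v)) as [E | E]; [| exact E].
generalize (polygon_period hL O H). rewrite E. simpl. generalize PI_RGT_0. lra.
Qed.

Lemma arg_lt (v : C) (k j : nat) : Lam v -> (k < j)%nat -> arg v k < arg v j.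
Proof.
intros H. induction 1 as [| j Hj IH];
  [generalize (polygon_turn hL k H) | generalize (polygon_turn hL j H)]; lra.
Qed.

Lemma arg_le (v : C) (k j : nat) : Lam v -> (k <= j)%nat -> arg v k <= arg v j.
Proof.
intros H Hk. apply Nat.lt_eq_cases in Hk. destruct Hk as [Hk | ->]; [| lra].
generalize (arg_lt v k j H Hk). lra.
Qed.

Lemma arg_period (v : C) (k m : nat) : Lam v ->
  arg v (k + m * deg v) = arg v k + 2 * PI * INR m.
Proof.
intros H. induction m as [| m IH].
- simpl. rewrite Nat.add_0_r. ring.
- rewrite S_INR. replace (k + S m * deg v)%nat with ((k + m * deg v) + deg v)%nat by lia.
  rewrite (polygon_period hL _ H), IH. ring.
Qed.

Lemma nb_period (v : C) (k m : nat) : Lam v -> nb v (k + m * deg v) = nb v k.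
Proof.
intros H. unfold Defs.nb. rewrite (arg_period v k m H), expi_add_2PI. reflexivity.
Qed.

(** Brings the index of one edge into the full turn that starts at another edge, so that their
    arguments can be compared as real numbers. *)
Lemma nb_reduce (v : C) (k j : nat) : Lam v ->
  exists k', (j <= k' < j + deg v)%nat /\ nb v k' = nb v k /\ nb v (S k') = nb v (S k).
Proof.
intros H. assert (Hd := deg_pos v H).
(* Adding [j] full turns makes the index at least [j], since [deg v] is positive, so the subtraction
   below is exact. *)
set (N := (k + j * deg v)%nat).
assert (HN : (j <= N)%nat) by (unfold N; nia).
exists (j + (N - j) mod deg v)%nat.
assert (Hm := Nat.mod_upper_bound (N - j) (deg v) ltac:(lia)).
split; [lia |].
assert (E := Nat.div_mod (N - j) (deg v) ltac:(lia)).
assert (EN : N = (j + (N - j) mod deg v + ((N - j) / deg v) * deg v)%nat) by lia.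
split.
- rewrite <- (nb_period v k j H). fold N. rewrite EN at 2.
  symmetry. apply nb_period. exact H.
- rewrite <- (nb_period v (S k) j H).
  replace (S k + j * deg v)%nat with (S N) by (unfold N; lia).
  rewrite EN at 2.
  rewrite <- (nb_period v (S (j + (N - j) mod deg v)) ((N - j) / deg v) H).
  f_equal.
Qed.

Lemma cross_nb (v : C) (k j : nat) :
  cross (nb v k - v) (nb v j - v) = delta * delta * sin (arg v j - arg v k).
Proof.
unfold Defs.nb, expi. rewrite cross_eq, sin_minus. simpl. ring.
Qed.

Lemma det_nb (v : C) (k : nat) : Lam v -> 0 < frame_det v (nb v k) (nb v (S k)).
Proof.
intro H. unfold frame_det. rewrite cross_nb.
assert (Hp := polygon_turn hL k H).
apply Rmult_lt_0_compat; [nra |]. apply sin_gt_0; lra.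
Qed.

Lemma rhombus_det (z a b c d : C) : rhombus z a b c d -> frame_det a b d <> 0.
Proof.
intros (Ha & k & -> & _ & -> & _). generalize (det_nb a k Ha). lra.
Qed.

Lemma rhombus_eq (z a b c d : C) : rhombus z a b c d ->
  c = (b + d - a)%C /\ z = ((a + c) / 2)%C.
Proof.
intros (Ha & k & -> & -> & -> & ->). unfold Defs.center, Defs.opp. split; reflexivity.
Qed.

(** This is where duality enters: [dual_edge] recognises the same rhombus among those based at the
    neighbouring vertex. *)
Lemma rhombus_turn (z a b c d : C) : rhombus z a b c d -> rhombus z d a b c.
Proof.
intros (Ha & k & -> & -> & -> & ->).
split; [now apply Lam_nb |].
destruct (dual_edge hL k Ha) as (j & H1 & H2).
assert (E : opp (nb a (S k)) j = nb a k).
{ unfold Defs.opp. rewrite H1, H2. unfold Defs.opp. ring. }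
exists j. rewrite E. repeat split; auto.
unfold Defs.center. rewrite E. unfold Defs.opp. f_equal. ring.
Qed.

Lemma rhombus_rotation (z a b c d a' b' c' d' : C) :
  rotation a b c d a' b' c' d' -> rhombus z a b c d -> rhombus z a' b' c' d'.
Proof.
intros [H | [H | [H | H]]] R; destruct H as (-> & -> & -> & ->);
  auto using rhombus_turn.
Qed.

Lemma rhombus_colour (z a b c d : C) : rhombus z a b c d ->
  (white L a /\ black L b /\ white L c /\ black L d) \/
  (black L a /\ white L b /\ black L c /\ white L d).
Proof.
intros R. destruct R as (Ha & k & -> & -> & -> & ->).
assert (Rb : rhombus (center a k) (nb a (S k)) a (nb a k) (opp a k)).
{ apply rhombus_turn. split; [exact Ha |]. exists k. auto. }
destruct Rb as (_ & m & _ & _ & Hm & _).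
destruct Ha as [Ha | Ha]; [right | left].
- split; [exact Ha |]. split; [now apply (black_nb hL) |].
  split; [| now apply (black_nb hL)].
  rewrite Hm. apply (white_nb hL). now apply (black_nb hL).
- split; [exact Ha |]. split; [now apply (white_nb hL) |].
  split; [| now apply (white_nb hL)].
  rewrite Hm. apply (black_nb hL). now apply (white_nb hL).
Qed.

Lemma affine_pt_turn (a b c d : C) (s t : R) : c = (b + d - a)%C ->
  affine_pt a b d s t = affine_pt d a c (1 - t) s.
Proof. intros ->. unfold affine_pt. C_field. Qed.

Lemma open_rhombus_rotation (z a b c d a' b' c' d' x : C) :
  rhombus z a b c d -> rotation a b c d a' b' c' d' ->
  open_rhombus a b d x -> open_rhombus a' b' d' x.
Proof.
assert (Rot : forall a b c d, rhombus z a b c d -> open_rhombus a b d x ->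
  open_rhombus d a c x).
{ clear. intros a b c d R (s & t & Hs & Ht & E).
  exists (1 - t), s. repeat split; try lra. rewrite E.
  apply (affine_pt_turn a b c d s t). apply (rhombus_eq z a b c d R). }
intros R [H | [H | [H | H]]] Hx; destruct H as (-> & -> & -> & ->);
  eauto 10 using rhombus_turn.
Qed.

(** A point on a side not containing the base vertex is described from another vertex, for which
    both coordinates become less than 1; this is the form required by [star]. *)
Lemma closed_rhombus_star (z a b c d x : C) :
  rhombus z a b c d -> closed_rhombus a b d x ->
  exists a' b' c' d' s t, rotation a b c d a' b' c' d' /\ rhombus z a' b' c' d' /\
    0 <= s < 1 /\ 0 <= t < 1 /\ x = affine_pt a' b' d' s t.
Proof.
intros R (s & t & Hs & Ht & E). change (x = affine_pt a b d s t) in E.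
assert (Ec := proj1 (rhombus_eq _ _ _ _ _ R)).
assert (R2 := rhombus_turn _ _ _ _ _ R).
assert (R3 := rhombus_turn _ _ _ _ _ R2).
assert (R4 := rhombus_turn _ _ _ _ _ R3).
destruct (Req_dec s 1) as [-> | Hs1]; destruct (Req_dec t 1) as [-> | Ht1].
- exists c, d, a, b, 0, 0. repeat split; try lra; unfold rotation; auto 7.
  + apply R3.
  + apply R3.
  + rewrite E, Ec. unfold affine_pt. C_field.
- exists b, c, d, a, t, 0. repeat split; try lra; unfold rotation; auto 7; try apply R4.
  rewrite E, Ec. unfold affine_pt. C_field.
- exists d, a, b, c, 0, s. repeat split; try lra; unfold rotation; auto 7; try apply R2.
  rewrite E, Ec. unfold affine_pt. C_field.
- exists a, b, c, d, s, t. repeat split; try lra; unfold rotation; auto 7; try apply R.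
Qed.

(** Cutting along the black diagonal gives two triangles with white apexes, each inside a face of
    Gamma; the point is moved if it lies on the cut. *)
Lemma rhombus_generic (z a b c d x : C) (P : C -> Prop) :
  rhombus z a b c d -> open_rhombus a b d x -> locally x P ->
  exists a' b' c' d' x', rotation a b c d a' b' c' d' /\ rhombus z a' b' c' d' /\
    white L a' /\ open_triangle a' b' d' x' /\ locally x' P.
Proof.
intros R Hx HP.
assert (W : exists a' b' c' d', rotation a b c d a' b' c' d' /\ rhombus z a' b' c' d' /\
  white L a' /\ white L c').
{ destruct (rhombus_colour _ _ _ _ _ R) as [(H & _ & H' & _) | (_ & H' & _ & H)].
  - exists a, b, c, d. unfold rotation. auto 6.
  - exists d, a, b, c. unfold rotation. auto 8 using rhombus_turn. }
destruct W as (a' & b' & c' & d' & Hcyc & R' & Wa & Wc).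
destruct (open_rhombus_rotation _ _ _ _ _ _ _ _ _ x R Hcyc Hx) as (s & t & Hs & Ht & E).
change (x = affine_pt a' b' d' s t) in E.
destruct (Rtotal_order (s + t) 1) as [Hst | [Hst | Hst]].
- exists a', b', c', d', x. repeat split; auto; try apply R'.
  exists s, t. repeat split; try lra. exact E.
(* On the black diagonal, a small move towards [a'] lowers both coordinates and enters the triangle
   at [a']. *)
- destruct (locally_direction x (affine_pt a' b' d' (-1) (-1) - a')%C _ (locally_locally _ _ HP))
    as (e & He & H).
  set (r := Rmin (e / 2) (Rmin s t / 2)).
  assert (Hm : 0 < Rmin s t) by (apply Rmin_glb_lt; lra).
  assert (Hr : 0 < r) by (unfold r; apply Rmin_glb_lt; lra).
  assert (r <= e / 2 /\ r <= Rmin s t / 2) as [Hr1 Hr2].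
  { unfold r. split; [apply Rmin_l | apply Rmin_r]. }
  generalize (Rmin_l s t) (Rmin_r s t). intros Hr3 Hr4.
  exists a', b', c', d', (x + RtoC r * (affine_pt a' b' d' (-1) (-1) - a'))%C.
  repeat split; auto; try apply R'.
  + exists (s - r), (t - r). repeat split; try lra. rewrite E. unfold affine_pt. C_field.
  + apply H. lra.
- exists c', d', a', b', x.
  assert (Hc2 : rotation a' b' c' d' c' d' a' b') by (unfold rotation; auto 7).
  split; [exact (rotation_trans _ _ _ _ _ _ _ _ _ _ _ _ Hcyc Hc2) |].
  split; [exact (rhombus_rotation _ _ _ _ _ _ _ _ _ Hc2 R') |].
  split; [exact Wc | split; [| exact HP]].
  + exists (1 - s), (1 - t). repeat split; try lra. rewrite E.
    rewrite (proj1 (rhombus_eq _ _ _ _ _ R')). unfold affine_pt. C_field.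
Qed.

(** * Faces, sectors and the absence of overlaps *)

Lemma chord_side (v : C) (j k : nat) : Lam v ->
  0 <= cross (nb v (S j) - nb v j) (nb v k - nb v j).
Proof.
intros H. destruct (nb_reduce v k j H) as (k' & Hk & <- & _).
destruct Hk as [Hk1 Hk2].
apply Nat.lt_eq_cases in Hk1. destruct Hk1 as [Hk1 | <-].
2: { rewrite cross_eq. simpl. right. ring. }
set (p := (arg v (S j) - arg v j) / 2).
set (q := (arg v k' - arg v (S j)) / 2).
(* Twice the area of a triangle inscribed in a circle of radius delta, whose angles are p, q and pi
   - p - q. *)
assert (E : cross (nb v (S j) - nb v j) (nb v k' - nb v j) =
  4 * (delta * delta) * (sin p * sin q * sin (p + q))).
{ transitivity (delta * delta * (sin (2 * p) + sin (2 * q) - sin (2 * (p + q)))).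
  - replace (2 * p) with (arg v (S j) - arg v j) by (unfold p; field).
    replace (2 * q) with (arg v k' - arg v (S j)) by (unfold q; field).
    replace (2 * (p + q)) with (arg v k' - arg v j) by (unfold p, q; field).
    rewrite !sin_minus, cross_eq. unfold Defs.nb, expi. simpl. ring.
  - rewrite !sin_2a, sin_plus, cos_plus.
    generalize (sin2_cos2 p) (sin2_cos2 q). unfold Rsqr. intros E1 E2.
    replace (cos p) with (cos p * 1) at 1 by ring. rewrite <- E2.
    replace (sin q * cos q) with (sin q * cos q * 1) by ring.
    replace (2 * sin q * cos q) with (2 * sin q * cos q * 1) by ring. rewrite <- E1.
    ring. }
rewrite E.
assert (H1 := polygon_turn hL j H).
assert (H2 := arg_le v (S j) k' H Hk1).
assert (H3 := arg_lt v k' (j + deg v) H Hk2).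
rewrite (polygon_period hL j H) in H3.
assert (0 < sin p) by (apply sin_gt_0; unfold p; lra).
assert (0 <= sin q) by (apply sin_ge_0; unfold q; lra).
assert (0 <= sin (p + q)) by (apply sin_ge_0; unfold p, q; lra).
repeat apply Rmult_le_pos; lra.
Qed.

Lemma triangle_face (w x : C) (k : nat) : Lam w ->
  open_triangle w (nb w k) (nb w (S k)) x -> face delta L w x.
Proof.
intros H (s & t & Hs & Ht & Hst & ->) j.
assert (H1 := chord_side w j k H). assert (H2 := chord_side w j (S k) H).
assert (H3 := det_nb w j H). unfold frame_det in H3.
assert (E : cross (nb w (S j) - nb w j)
    (w + RtoC s * (nb w k - w) + RtoC t * (nb w (S k) - w) - nb w j) =
  (1 - s - t) * cross (nb w j - w) (nb w (S j) - w) +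
  s * cross (nb w (S j) - nb w j) (nb w k - nb w j) +
  t * cross (nb w (S j) - nb w j) (nb w (S k) - nb w j)).
{ rewrite !cross_eq. simpl. ring. }
rewrite E.
assert (0 < (1 - s - t) * cross (nb w j - w) (nb w (S j) - w)) by (apply Rmult_lt_0_compat; lra).
assert (0 <= s * cross (nb w (S j) - nb w j) (nb w k - nb w j)) by (apply Rmult_le_pos; lra).
assert (0 <= t * cross (nb w (S j) - nb w j) (nb w (S k) - nb w j)) by (apply Rmult_le_pos; lra).
lra.
Qed.

Lemma sector_angle (v X : C) (k : nat) (s t : R) : Lam v -> 0 < s -> 0 < t ->
  X = affine_pt v (nb v k) (nb v (S k)) s t ->
  exists f r, arg v k < f < arg v (S k) /\ 0 < r /\ X = (v + RtoC r * expi f)%C.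
Proof.
intros H Hs Ht E. assert (Hd := det_nb v k H). assert (Hp := polygon_turn hL k H).
assert (HX : (X - v)%C <> 0%C).
{ intro E0. assert (E' : X = affine_pt v (nb v k) (nb v (S k)) 0 0).
  { replace X with (X - v + v)%C by ring. rewrite E0. unfold affine_pt. C_field. }
  rewrite E' in E. apply affine_pt_inj in E; lra. }
destruct (polar (X - v) (arg v k) HX) as (f & Hf & Ef).
assert (Hr := proj1 (Cmod_gt_0 _) HX).
set (r := Cmod (X - v)) in *.
exists f, r. split; [| split; [exact Hr |]].
2: { rewrite <- Ef. ring. }
assert (E1 : cross (nb v k - v) (X - v) = delta * r * sin (f - arg v k)).
{ rewrite Ef. unfold Defs.nb, expi. rewrite cross_eq, sin_minus. simpl. ring. }
assert (E2 : cross (X - v) (nb v (S k) - v) = delta * r * sin (arg v (S k) - f)).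
{ rewrite Ef. unfold Defs.nb, expi. rewrite cross_eq, sin_minus. simpl. ring. }
assert (E3 : cross (nb v k - v) (X - v) = t * frame_det v (nb v k) (nb v (S k))).
{ rewrite E. unfold affine_pt, frame_det. rewrite !cross_eq. simpl. ring. }
assert (E4 : cross (X - v) (nb v (S k) - v) = s * frame_det v (nb v k) (nb v (S k))).
{ rewrite E. unfold affine_pt, frame_det. rewrite !cross_eq. simpl. ring. }
assert (P1 : 0 < t * frame_det v (nb v k) (nb v (S k))) by (apply Rmult_lt_0_compat; lra).
assert (P2 : 0 < s * frame_det v (nb v k) (nb v (S k))) by (apply Rmult_lt_0_compat; lra).
assert (Hdr : 0 < delta * r) by (apply Rmult_lt_0_compat; lra).
rewrite <- E3, E1 in P1. rewrite <- E4, E2 in P2.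
assert (S1 : 0 < sin (f - arg v k)) by (apply Rmult_lt_reg_l with (delta * r); lra).
assert (S2 : 0 < sin (arg v (S k) - f)) by (apply Rmult_lt_reg_l with (delta * r); lra).
assert (F1 : arg v k < f).
{ destruct Hf as [[Hf | Hf] _]; [exact Hf |]. rewrite <- Hf, Rminus_diag, sin_0 in S1. lra. }
assert (F2 : f - arg v k < PI).
{ destruct (Rlt_le_dec (f - arg v k) PI) as [Hl | Hl]; [exact Hl |].
  assert (sin (f - arg v k) <= 0) by (apply sin_le_0; lra). lra. }
split; [exact F1 |].
destruct (Rlt_le_dec f (arg v (S k))) as [Hl | Hl]; [exact Hl |].
assert (0 <= sin (f - arg v (S k))) by (apply sin_ge_0; lra).
replace (f - arg v (S k)) with (- (arg v (S k) - f)) in H0 by ring.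
rewrite sin_neg in H0. lra.
Qed.

(** The common point has an argument strictly inside each sector. With the indices taken in one full
    turn, distinct sectors are disjoint intervals of a window of length 2 pi, where the argument is
    unique. *)
Lemma sector_disjoint (v x : C) (k j : nat) : Lam v ->
  open_triangle v (nb v k) (nb v (S k)) x ->
  open_triangle v (nb v j) (nb v (S j)) x ->
  nb v k = nb v j /\ nb v (S k) = nb v (S j).
Proof.
intros H. destruct (nb_reduce v j k H) as (j' & Hj & <- & <-).
intros (s & t & Hs & Ht & _ & E) (s' & t' & Hs' & Ht' & _ & E').
destruct (sector_angle v x k s t H Hs Ht E) as (f & r & Hf & Hr & Ex).
destruct (sector_angle v x j' s' t' H Hs' Ht' E') as (f' & r' & Hf' & Hr' & Ex').
destruct (Nat.eq_dec k j') as [-> | Hkj]; [auto | exfalso].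
assert (H1 := arg_le v (S k) j' H ltac:(lia)).
assert (H2 := arg_le v (S j') (k + deg v) H ltac:(lia)).
rewrite (polygon_period hL k H) in H2.
assert (Hk := polygon_turn hL k H).
assert (Eq : (RtoC r * expi f)%C = (RtoC r' * expi f')%C).
{ transitivity (x - v)%C; [rewrite Ex | rewrite Ex']; ring. }
assert (Hrr : r = r').
{ apply (f_equal Cmod) in Eq. rewrite !Cmod_mult, !Cmod_R in Eq.
  rewrite !Cmod_expi, !Rabs_pos_eq in Eq by lra. lra. }
subst r'.
assert (Ef : expi f = expi f').
{ assert (Z : RtoC r <> 0%C) by (intro Z; injection Z; lra).
  replace (expi f) with (/ RtoC r * (RtoC r * expi f))%C by (field; exact Z).
  rewrite Eq. field. exact Z. }
apply expi_inj in Ef; lra.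
Qed.

Lemma rhombus_overlap (z a b c d z' a' b' c' d' x : C) :
  rhombus z a b c d -> rhombus z' a' b' c' d' ->
  open_rhombus a b d x -> open_rhombus a' b' d' x ->
  z = z' /\ rotation a b c d a' b' c' d'.
Proof.
intros R R' Hx Hx'.
destruct (rhombus_generic z a b c d x _ R Hx
  (open_rhombus_open _ _ _ _ (rhombus_det _ _ _ _ _ R') Hx'))
  as (a1 & b1 & c1 & d1 & x1 & C1 & R1 & W1 & T1 & P1).
apply locally_singleton in P1.
(* The second displacement is kept small enough to stay in the first triangle, so [x2] lies in
   white-apexed triangles of both rhombi; disjointness of faces identifies the apexes. *)
destruct (rhombus_generic z' a' b' c' d' x1 _ R' P1
  (open_triangle_open _ _ _ _ (rhombus_det _ _ _ _ _ R1) T1))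
  as (a2 & b2 & c2 & d2 & x2 & C2 & R2 & W2 & T2 & P2).
apply locally_singleton in P2.
destruct R1 as (L1 & k & -> & -> & -> & ->).
destruct R2 as (L2 & j & -> & -> & -> & ->).
assert (E : a1 = a2).
{ apply (face_disjoint hL (w1 := a1) (w2 := a2) (x := x2) W1 W2);
    [apply (triangle_face a1 x2 k) | apply (triangle_face a2 x2 j)]; auto. }
subst a2.
destruct (sector_disjoint a1 x2 k j L1 P2 T2) as [E1 E2].
assert (Eo : opp a1 k = opp a1 j) by (unfold Defs.opp; rewrite E1, E2; reflexivity).
split.
- unfold Defs.center. rewrite Eo. reflexivity.
- apply (rotation_trans _ _ _ _ _ _ _ _ _ _ _ _ C1). apply rotation_sym.
  rewrite E1, E2, Eo. exact C2.
Qed.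

Lemma center_in_rhombus (z a b c d : C) : rhombus z a b c d -> open_rhombus a b d z.
Proof.
intros R. destruct (rhombus_eq _ _ _ _ _ R) as [-> ->].
exists (/ 2), (/ 2). repeat split; try lra. C_field.
Qed.

Lemma rhombus_labels (z a b c d a' b' c' d' : C) :
  rhombus z a b c d -> rhombus z a' b' c' d' -> rotation a b c d a' b' c' d'.
Proof.
intros R R'. apply (rhombus_overlap z a b c d z a' b' c' d' z R R');
  eapply center_in_rhombus; eassumption.
Qed.

(** * Vertices of rhombi and open stars *)

Definition vertex_of (z v : C) : Prop := exists b c d, rhombus z v b c d.

Lemma vertex_of_center (v : C) (k : nat) : Lam v -> vertex_of (center v k) v.
Proof. intros H. exists (nb v k), (opp v k), (nb v (S k)). split; [exact H | exists k; auto]. Qed.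

Lemma vertex_of_cases (z a b c d v : C) : rhombus z a b c d -> vertex_of z v ->
  v = a \/ v = b \/ v = c \/ v = d.
Proof.
intros R (b' & c' & d' & R'). generalize (rhombus_labels _ _ _ _ _ _ _ _ _ R R').
unfold rotation. tauto.
Qed.

Lemma vertex_of_Lam (z v : C) : vertex_of z v -> Lam v.
Proof. intros (b & c & d & H & _). exact H. Qed.

(** Distinct vertices of one colour are opposite, so they determine the rhombus through its centre.
    Later arguments identify cells in this way. *)
Lemma vertex_of_same_colour (z v v' : C) : vertex_of z v -> vertex_of z v' -> v <> v' ->
  (black L v /\ black L v') \/ (white L v /\ white L v') -> z = ((v + v') / 2)%C.
Proof.
intros (b & c & d & R) V' Hne Hcol.
destruct (rhombus_eq _ _ _ _ _ R) as [_ Ez].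
destruct (rhombus_colour _ _ _ _ _ R) as [(A1 & A2 & A3 & A4) | (A1 & A2 & A3 & A4)];
destruct (vertex_of_cases _ _ _ _ _ _ R V') as [E | [E | [E | E]]]; subst v';
  try congruence; destruct Hcol as [[? ?] | [? ?]]; clash.
Qed.

Lemma vertex_of_edge (z u w : C) : vertex_of z u -> vertex_of z w -> black L u -> white L w ->
  rhombus_edge delta L z u w.
Proof.
intros (b & c & d & R) Vw Hu Hw. split; [exact Hu | split; [exact Hw |]].
destruct (rhombus_colour _ _ _ _ _ R) as [(A1 & A2 & A3 & A4) | (A1 & A2 & A3 & A4)];
  [clash |].
destruct (vertex_of_cases _ _ _ _ _ _ R Vw) as [E | [E | [E | E]]]; subst w.
- clash.
- left. exists c, d. exact R.
- clash.
- right. exists b, c. exact R.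
Qed.

(** The half-open rhombi retain the apex and the sides issuing from it and drop the other two sides,
    so that their union is an open set. *)
Definition star (v x : C) : Prop := Lam v /\ exists k s t,
  0 <= s < 1 /\ 0 <= t < 1 /\ x = affine_pt v (nb v k) (nb v (S k)) s t.

Lemma star_self (v : C) : Lam v -> star v v.
Proof.
intros H. split; [exact H |]. exists O, 0, 0. repeat split; try lra. unfold affine_pt. C_field.
Qed.

Lemma find_sector (v : C) (f : R) (n : nat) : arg v 0 <= f < arg v n ->
  exists k, arg v k <= f < arg v (S k).
Proof.
induction n as [| n IH]; [lra |]. intros [H1 H2].
destruct (Rlt_le_dec f (arg v n)) as [H | H]; [apply IH; lra |].
exists n. lra.
Qed.

Lemma star_near_apex (v : C) : Lam v -> locally v (star v).
Proof.
intros H. assert (HP := PI_RGT_0).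
assert (Hs : 0 < sin eta).
{ apply sin_gt_0; [exact heta |]. generalize (hangles v O H). lra. }
(* At distance r from [v], the coordinates in a sector of angle th are r times a sine, divided by
   delta sin th. They are below 1 if r < delta sin eta, and half of this suffices for the
   coordinatewise ball. *)
assert (Hr : 0 < delta * sin eta / 2) by nra.
exists (mkposreal _ Hr). intros y Hy. apply ball_C_iff in Hy. simpl in Hy.
destruct (classic ((y - v)%C = 0%C)) as [E0 | HX].
{ replace y with v; [now apply star_self |].
  replace y with (y - v + v)%C by ring. rewrite E0. ring. }
destruct (polar (y - v) (arg v 0) HX) as (f & Hf & Ef).
rewrite <- (polygon_period hL O H) in Hf.
destruct (find_sector v f _ Hf) as (k & Hk).
assert (Hm := proj1 (Cmod_gt_0 _) HX).
assert (Hlt : Cmod (y - v) < delta * sin eta).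
{ apply Rle_lt_trans with (Rabs (fst (y - v)%C) + Rabs (snd (y - v)%C)).
  - unfold Cmod. generalize (Rabs_pos (fst (y - v)%C)) (Rabs_pos (snd (y - v)%C)). intros P1 P2.
    rewrite <- (sqrt_Rsqr (Rabs (fst (y - v)%C) + Rabs (snd (y - v)%C))) by lra.
    apply sqrt_le_1_alt. unfold Rsqr.
    assert (Q1 := Rsqr_abs (fst (y - v)%C)). assert (Q2 := Rsqr_abs (snd (y - v)%C)).
    unfold Rsqr in Q1, Q2. nra.
  - replace (delta * sin eta) with (delta * sin eta / 2 + delta * sin eta / 2) by field.
    apply Rplus_lt_compat; apply Hy. }
set (r := Cmod (y - v)) in *.
assert (Ha := hangles v k H). assert (Hp := polygon_turn hL k H).
assert (Hsk : sin eta <= sin (arg v (S k) - arg v k)).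
{ destruct (Rle_dec (arg v (S k) - arg v k) (PI / 2)).
  - apply sin_incr_1; lra.
  - rewrite <- (sin_PI_x eta). apply sin_decr_1; lra. }
set (th := arg v (S k) - arg v k) in *.
assert (Hb : forall g, 0 <= g < PI -> 0 <= r * sin g / (delta * sin th) < 1).
{ intros g Hg.
  assert (0 <= sin g) by (apply sin_ge_0; lra).
  assert (sin g <= 1) by apply SIN_bound.
  assert (0 < delta * sin th) by nra.
  split.
  - apply Rdiv_le_0_compat; [nra | assumption].
  - apply Rmult_lt_reg_r with (delta * sin th); [assumption |].
    unfold Rdiv. rewrite Rmult_assoc, Rinv_l, Rmult_1_r by lra. nra. }
split; [exact H |].
exists k, (r * sin (arg v (S k) - f) / (delta * sin th)),
  (r * sin (f - arg v k) / (delta * sin th)).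
assert (Eth : th = arg v (S k) - arg v k) by reflexivity.
split; [apply Hb; lra | split; [apply Hb; lra |]].
replace y with (v + (y - v))%C by ring. rewrite Ef. fold r.
assert (Hth : sin th <> 0) by lra.
assert (I1 : cos f * sin th = sin (arg v (S k) - f) * cos (arg v k) +
  sin (f - arg v k) * cos (arg v (S k))).
{ rewrite Eth, !sin_minus. ring. }
assert (I2 : sin f * sin th = sin (arg v (S k) - f) * sin (arg v k) +
  sin (f - arg v k) * sin (arg v (S k))).
{ rewrite Eth, !sin_minus. ring. }
clearbody th.
unfold affine_pt, Defs.nb, expi. apply injective_projections; simpl.
- replace (cos f) with (cos f * sin th / sin th) by (field; exact Hth).
  rewrite I1. field. split; lra.
- replace (sin f) with (sin f * sin th / sin th) by (field; exact Hth).
  rewrite I2. field. split; lra.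
Qed.

Lemma star_near_edge (v : C) (k : nat) (s : R) : Lam v -> 0 < s < 1 ->
  locally (affine_pt v (nb v k) (nb v (S k)) s 0) (star v).
Proof.
intros H Hs. assert (Hdeg := deg_pos v H).
(* The sector preceding the edge [k]; a full turn is added first because [k] may be 0. *)
assert (Hk : exists j, nb v (S j) = nb v k /\ nb v (S (S j)) = nb v (S k)).
{ exists (k + 1 * deg v - 1)%nat.
  replace (S (k + 1 * deg v - 1)) with (k + 1 * deg v)%nat by lia.
  split; [now apply nb_period |].
  change (S (k + 1 * deg v)) with (S k + 1 * deg v)%nat. now apply nb_period. }
destruct Hk as (j & E1 & E2).
set (e := Rmin s (1 - s)).
assert (He : 0 < e) by (unfold e; apply Rmin_glb_lt; lra).
assert (e <= s /\ e <= 1 - s) as [He1 He2] by (unfold e; split; [apply Rmin_l | apply Rmin_r]).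
assert (D1 := det_nb v k H). assert (D2 := det_nb v j H).
assert (Ex : affine_pt v (nb v k) (nb v (S k)) s 0 = affine_pt v (nb v j) (nb v (S j)) 0 s).
{ rewrite E1. unfold affine_pt. C_field. }
assert (N1 := locally_coords v (nb v k) (nb v (S k)) _ s 0 e (Rgt_not_eq _ _ D1) He eq_refl).
assert (N2 := locally_coords v (nb v j) (nb v (S j)) _ 0 s e (Rgt_not_eq _ _ D2) He Ex).
generalize (filter_and _ _ N1 N2).
apply filter_imp. intros y ((s1 & t1 & Y1 & A1 & B1) & (s2 & t2 & Y2 & A2 & B2)).
apply Rabs_lt_bounds in A1, B1, A2, B2.
split; [exact H |].
destruct (Rle_dec 0 t1) as [Ht | Ht].
- exists k, s1, t1. repeat split; try lra. exact Y1.
- exists j, s2, t2. repeat split; try lra; [| exact Y2].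
  assert (C1 : cross (nb v k - v) (y - v) = t1 * frame_det v (nb v k) (nb v (S k))).
  { rewrite Y1. unfold affine_pt, frame_det. rewrite !cross_eq. simpl. ring. }
  assert (C2 : cross (nb v k - v) (y - v) = - s2 * frame_det v (nb v j) (nb v (S j))).
  { rewrite Y2, E1. unfold affine_pt, frame_det. rewrite !cross_eq. simpl. ring. }
  nra.
Qed.

Lemma star_open (v x : C) : star v x -> locally x (star v).
Proof.
intros (H & k & s & t & Hs & Ht & E).
destruct (Req_dec s 0) as [-> | Hs0]; destruct (Req_dec t 0) as [-> | Ht0].
- replace x with v; [now apply star_near_apex |]. rewrite E. unfold affine_pt. C_field.
- replace x with (affine_pt v (nb v (S k)) (nb v (S (S k))) t 0).
  + apply star_near_edge; [exact H | lra].
  + rewrite E. unfold affine_pt. C_field.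
- rewrite E. apply star_near_edge; [exact H | lra].
- assert (D := det_nb v k H).
  generalize (open_rhombus_open v (nb v k) (nb v (S k)) x ltac:(lra)).
  intro O. assert (Ox : open_rhombus v (nb v k) (nb v (S k)) x).
  { exists s, t. repeat split; try lra. exact E. }
  generalize (O Ox). apply filter_imp. intros y (s' & t' & Hs' & Ht' & Ey).
  split; [exact H |]. exists k, s', t'. repeat split; try lra. exact Ey.
Qed.

(* An arbitrarily small displacement puts the point into the interiors of a
   rhombus at [v] and of the given one, so [rhombus_overlap] applies. *)
Lemma star_vertex_of (v x : C) : star v x ->
  locally x (fun y => forall z a b c d, rhombus z a b c d -> closed_rhombus a b d y ->
    vertex_of z v).
Proof.
intros Hx. generalize (locally_locally _ _ (star_open v x Hx)). apply filter_imp.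
intros y Hy z a b c d R (s & t & Hs & Ht & Ey). change (y = affine_pt a b d s t) in Ey.
assert (Dz := rhombus_det _ _ _ _ _ R).
destruct (locally_direction y (z - y) _ Hy) as (e & He & H).
set (r := Rmin (e / 2) (/ 2)).
assert (Hr : 0 < r) by (unfold r; apply Rmin_glb_lt; lra).
assert (r <= e / 2 /\ r <= / 2) as [Hr1 Hr2] by (unfold r; split; [apply Rmin_l | apply Rmin_r]).
set (y1 := (y + RtoC r * (z - y))%C).
assert (S1 : star v y1) by (apply H; lra).
assert (O1 : open_rhombus a b d y1).
{ exists ((1 - r) * s + r / 2), ((1 - r) * t + r / 2). repeat split; try nra.
  unfold y1. rewrite Ey. destruct (rhombus_eq _ _ _ _ _ R) as [-> ->]. unfold affine_pt. C_field. }
destruct S1 as (Hv & k & s1 & t1 & Hs1 & Ht1 & E1).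
destruct (locally_direction y1 (nb v k - v + (nb v (S k) - v)) _
  (open_rhombus_open _ _ _ _ Dz O1)) as (e' & He' & H').
set (r' := Rmin (e' / 2) (Rmin ((1 - s1) / 2) ((1 - t1) / 2))).
assert (Hr' : 0 < r') by (unfold r'; repeat apply Rmin_glb_lt; lra).
assert (r' <= e' / 2 /\ r' <= (1 - s1) / 2 /\ r' <= (1 - t1) / 2) as (Q1 & Q2 & Q3).
{ unfold r'. generalize (Rmin_l (e' / 2) (Rmin ((1 - s1) / 2) ((1 - t1) / 2)))
   (Rmin_r (e' / 2) (Rmin ((1 - s1) / 2) ((1 - t1) / 2)))
   (Rmin_l ((1 - s1) / 2) ((1 - t1) / 2)) (Rmin_r ((1 - s1) / 2) ((1 - t1) / 2)). lra. }
destruct (rhombus_overlap z a b c d (center v k) v (nb v k) (opp v k) (nb v (S k))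
  (y1 + RtoC r' * (nb v k - v + (nb v (S k) - v)))%C) as [-> _].
- exact R.
- split; [exact Hv |]. exists k. auto.
- apply H'. lra.
- exists (s1 + r'), (t1 + r'). repeat split; try lra. rewrite E1. unfold affine_pt. C_field.
- now apply vertex_of_center.
Qed.

(** By [star_vertex_of] at [a], a rhombus at [v] containing [a] has [a] as a vertex, and its
    vertices other than [v] have a coordinate equal to 1. *)
Lemma star_vertex (v a : C) : Lam a -> star v a -> a = v.
Proof.
intros Ha (Hv & k & s & t & Hs & Ht & E).
assert (V : vertex_of (center v k) a).
{ refine (locally_singleton _ _ (star_vertex_of a a (star_self a Ha)) _
    v (nb v k) (opp v k) (nb v (S k)) _ _).
  - split; [exact Hv |]. exists k. auto.
  - exists s, t. repeat split; try lra. exact E. }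
assert (D := det_nb v k Hv).
assert (I : forall s' t', a = affine_pt v (nb v k) (nb v (S k)) s' t' -> s' = s /\ t' = t).
{ intros s' t' E'. rewrite E in E'. apply affine_pt_inj in E'; lra. }
destruct (vertex_of_cases (center v k) v (nb v k) (opp v k) (nb v (S k)) a) as [A | [A | [A | A]]].
- split; [exact Hv |]. exists k. auto.
- exact V.
- exact A.
- destruct (I 1 0); [| lra]. rewrite A. unfold affine_pt. C_field.
- destruct (I 1 1); [| lra]. rewrite A. unfold affine_pt, Defs.opp. C_field.
- destruct (I 0 1); [| lra]. rewrite A. unfold affine_pt. C_field.
Qed.

Lemma nb_inj (v : C) (k j : nat) : Lam v -> nb v k = nb v j -> nb v (S k) = nb v (S j).
Proof.
intros H E. destruct (nb_reduce v j k H) as (j' & Hj & E1 & <-).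
destruct (Nat.eq_dec k j') as [-> | Hkj]; [reflexivity | exfalso].
assert (H1 := arg_lt v k j' H ltac:(lia)).
assert (H2 := arg_lt v j' (k + deg v) H ltac:(lia)).
rewrite (polygon_period hL k H) in H2.
assert (Z : RtoC delta <> 0%C) by (intro Z; injection Z; lra).
assert (Ef : expi (arg v k) = expi (arg v j')).
{ rewrite <- E1 in E. unfold Defs.nb in E.
  transitivity (/ RtoC delta * (v + RtoC delta * expi (arg v k) - v))%C; [field; exact Z |].
  rewrite E. field. exact Z. }
apply expi_inj in Ef; lra.
Qed.

Lemma rhombus_on_edge (z z' a b c d c' d' : C) :
  rhombus z a b c d -> rhombus z' a b c' d' -> z = z' /\ c = c' /\ d = d'.
Proof.
intros (Ha & k & -> & -> & -> & ->) (_ & j & E & -> & -> & ->).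
assert (E2 := nb_inj a k j Ha E).
assert (Eo : opp a k = opp a j) by (unfold Defs.opp; rewrite E, E2; reflexivity).
unfold Defs.center. rewrite Eo, E2. auto.
Qed.

Lemma rhombus_distinct (z a b c d : C) : rhombus z a b c d -> a <> b /\ a <> c /\ a <> d.
Proof.
intros R. assert (D := rhombus_det _ _ _ _ _ R).
rewrite (proj1 (rhombus_eq _ _ _ _ _ R)).
assert (E0 : a = affine_pt a b d 0 0) by (unfold affine_pt; C_field).
repeat split; intro E; rewrite E0 in E at 1.
- replace b with (affine_pt a b d 1 0) in E at 2 by (unfold affine_pt; C_field).
  apply affine_pt_inj in E; lra.
- replace (b + d - a)%C with (affine_pt a b d 1 1) in E by (unfold affine_pt; C_field).
  apply affine_pt_inj in E; lra.
- replace d with (affine_pt a b d 0 1) in E at 2 by (unfold affine_pt; C_field).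
  apply affine_pt_inj in E; lra.
Qed.

Lemma rhombus_apex (z a b c d b' c' d' : C) :
  rhombus z a b c d -> rhombus z a b' c' d' -> b = b' /\ c = c' /\ d = d'.
Proof.
intros R R'. destruct (rhombus_distinct _ _ _ _ _ R) as (N1 & N2 & N3).
destruct (rhombus_labels _ _ _ _ _ _ _ _ _ R R') as [H | [H | [H | H]]];
  destruct H as (H1 & -> & -> & ->); auto; contradiction.
Qed.

Lemma star_of_rhombus (z a b c d x : C) (s t : R) : rhombus z a b c d ->
  0 <= s < 1 -> 0 <= t < 1 -> x = affine_pt a b d s t -> star a x.
Proof.
intros (Ha & k & -> & _ & -> & _) Hs Ht E. split; [exact Ha |]. exists k, s, t. auto.
Qed.

(** An inner point belongs to the stars of two opposite vertices. Any rhombus reaching close to it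
    has both as vertices, and their midpoint is its centre. *)
Lemma open_rhombus_near (z a b c d x : C) : rhombus z a b c d -> open_rhombus a b d x ->
  locally x (fun y => forall z' a' b' c' d', rhombus z' a' b' c' d' ->
    closed_rhombus a' b' d' y -> z' = z).
Proof.
intros R (s & t & Hs & Ht & E). change (x = affine_pt a b d s t) in E.
destruct (rhombus_eq _ _ _ _ _ R) as [Ec Ez].
assert (R2 : rhombus z c d a b) by (now do 2 apply rhombus_turn).
assert (S1 : star a x) by (apply (star_of_rhombus z a b c d x s t R); [lra | lra | exact E]).
assert (S2 : star c x).
{ apply (star_of_rhombus z c d a b x (1 - s) (1 - t) R2); [lra | lra |].
  rewrite E, Ec. unfold affine_pt. C_field. }
generalize (filter_and _ _ (star_vertex_of a x S1) (star_vertex_of c x S2)). apply filter_imp.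
intros y [H1 H2] z' a' b' c' d' R' Hy. rewrite Ez.
apply (vertex_of_same_colour z' a c).
- exact (H1 _ _ _ _ _ R' Hy).
- exact (H2 _ _ _ _ _ R' Hy).
- apply (rhombus_distinct _ _ _ _ _ R).
- destruct (rhombus_colour _ _ _ _ _ R); tauto.
Qed.

(** A third vertex has the colour of one end of the common side, so the two rhombi share a pair of
    opposite vertices. *)
Lemma third_vertex (z z' e f g : C) : black L e -> white L f ->
  vertex_of z e -> vertex_of z f -> vertex_of z g ->
  vertex_of z' e -> vertex_of z' f -> vertex_of z' g ->
  g <> e -> g <> f -> z = z'.
Proof.
intros He Hf Ve Vf Vg Ve' Vf' Vg' N1 N2.
destruct (vertex_of_Lam _ _ Vg) as [Hg | Hg].
- rewrite (vertex_of_same_colour z g e), (vertex_of_same_colour z' g e); auto.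
- rewrite (vertex_of_same_colour z g f), (vertex_of_same_colour z' g f); auto.
Qed.

Lemma edge_vertices (z u w : C) : rhombus_edge delta L z u w -> vertex_of z u /\ vertex_of z w.
Proof.
intros (_ & _ & [(c & d & R) | (b & c & R)]).
- split; [exists w, c, d; exact R |]. exists c, d, u. now do 3 apply rhombus_turn.
- split; [exists b, c, w; exact R |]. exists u, b, c. now apply rhombus_turn.
Qed.

Lemma edge_length (z u w : C) : rhombus_edge delta L z u w -> Cmod (Ci * (w - u)) = delta.
Proof.
assert (H : forall k, Cmod (Ci * (nb u k - u)) = delta).
{ intro k. replace (nb u k - u)%C with (RtoC delta * expi (arg u k))%C.
  2: { unfold Defs.nb. ring. }
  rewrite !Cmod_mult, Cmod_R, Rabs_pos_eq, Cmod_expi by lra.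
  replace (Cmod Ci) with 1; [ring |].
  unfold Cmod, Ci. simpl. transitivity (sqrt 1); [symmetry; apply sqrt_1 | f_equal; ring]. }
intros (_ & _ & [(c & d & R) | (b & c & R)]).
- destruct R as (_ & k & -> & _). apply H.
- destruct R as (_ & k & _ & _ & -> & _). apply H.
Qed.

(** * The Laplacian at a vertex *)

(* The half-line [i (w - u)] of the edge number [k] at [v] has argument
   [2 * half_dir v k], with [s = 1] if [v = u] is black and [s = -1] if [v = w]. *)
Definition half_dir (s : R) (v : C) (k : nat) : R := arg v k / 2 + s * (PI / 4).

Lemma edge_expi (s : R) (v : C) (k : nat) : s = 1 \/ s = -1 ->
  (Ci * RtoC s * (nb v k - v))%C = (RtoC delta * expi (2 * half_dir s v k))%C.
Proof.
intros Hs. unfold Defs.nb, half_dir, expi.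
destruct Hs as [-> | ->].
- replace (2 * (arg v k / 2 + 1 * (PI / 4))) with (PI / 2 + arg v k) by field.
  rewrite cos_plus, sin_plus, cos_PI2, sin_PI2. C_field.
- replace (2 * (arg v k / 2 + -1 * (PI / 4))) with (arg v k - PI / 2) by field.
  rewrite cos_minus, sin_minus, cos_PI2, sin_PI2. C_field.
Qed.

(** In the frame turned by the bisecting half-direction [m], where F e^(im) has coordinates [g1] and
    [g2], both sides equal - 2 delta sin (2h) (g1^2 - g2^2). *)
Lemma term_qform (s : R) (v : C) (k : nat) (F : C) : s = 1 \/ s = -1 -> Lam v ->
  s * (tan (half_angle L v k) * Im ((opp v k - v) * F ^ 2)%C) =
  2 * delta * qform (half_dir s v (S k) - half_dir s v k)
    (proj_coef F (half_dir s v k)) (proj_coef F (half_dir s v (S k))).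
Proof.
intros Hs Hv. assert (Hp := polygon_turn hL k Hv).
set (f := half_dir s v k). set (f' := half_dir s v (S k)).
set (m := (f + f') / 2). set (h := (f' - f) / 2).
assert (Eh : half_angle L v k = 2 * h) by (unfold half_angle, h, f, f', half_dir; field).
assert (Ed : f' - f = 2 * h) by (unfold h; field).
assert (Ef : f = m - h) by (unfold m, h; field).
assert (Ef' : f' = m + h) by (unfold m, h; field).
set (g1 := fst F * cos m - snd F * sin m).
set (g2 := fst F * sin m + snd F * cos m).
assert (C1 : proj_coef F f = g1 * cos h + g2 * sin h).
{ rewrite Ef. unfold proj_coef, g1, g2. rewrite cos_minus, sin_minus. ring. }
assert (C2 : proj_coef F f' = g1 * cos h - g2 * sin h).
{ rewrite Ef'. unfold proj_coef, g1, g2. rewrite cos_plus, sin_plus. ring. }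
assert (Eo : (opp v k - v)%C =
  ((nb v k - v) + (nb v (S k) - v))%C) by (unfold Defs.opp; ring).
assert (Ee : forall j, (nb v j - v)%C =
  (- (Ci * RtoC s) * (RtoC delta * expi (2 * half_dir s v j)))%C).
{ intro j. rewrite <- (edge_expi s v j Hs). destruct Hs as [-> | ->]; C_field. }
rewrite Eo, !Ee. fold f f'. rewrite C1, C2, Eh, Ed.
assert (EI : s * Im ((- (Ci * RtoC s) * (RtoC delta * expi (2 * f)) +
    - (Ci * RtoC s) * (RtoC delta * expi (2 * f'))) * F ^ 2)%C =
  - (2 * delta * cos (2 * h) * (g1 * g1 - g2 * g2))).
{ replace (2 * f) with (2 * m - 2 * h) by (rewrite Ef; ring).
  replace (2 * f') with (2 * m + 2 * h) by (rewrite Ef'; ring).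
  unfold expi. rewrite cos_minus, sin_minus, cos_plus, sin_plus, (cos_2a m), (sin_2a m).
  unfold g1, g2. destruct Hs as [-> | ->]; simpl; ring. }
assert (Hc : 0 < cos (2 * h)) by (apply cos_gt_0; unfold h, f, f', half_dir; lra).
assert (Hn : 0 < sin (2 * h)) by (apply sin_gt_0; unfold h, f, f', half_dir; lra).
transitivity (tan (2 * h) * - (2 * delta * cos (2 * h) * (g1 * g1 - g2 * g2))).
{ rewrite <- EI. ring. }
assert (P := sin2_cos2 h). unfold Rsqr in P.
assert (N : cos (2 * h) * ((g1 * cos h + g2 * sin h) * (g1 * cos h + g2 * sin h) +
    (g1 * cos h - g2 * sin h) * (g1 * cos h - g2 * sin h)) -
    2 * (g1 * cos h + g2 * sin h) * (g1 * cos h - g2 * sin h) =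
  - (sin (2 * h) * sin (2 * h) * (g1 * g1 - g2 * g2))).
{ rewrite cos_2a, sin_2a.
  transitivity (2 * (cos h * cos h - sin h * sin h) *
      (g1 * g1 * (cos h * cos h) + g2 * g2 * (sin h * sin h)) -
    2 * (sin h * sin h + cos h * cos h) *
      (g1 * g1 * (cos h * cos h) - g2 * g2 * (sin h * sin h))).
  - rewrite P. ring.
  - ring. }
unfold tan, qform. rewrite N. field. split; lra.
Qed.

Lemma laplacian_sign (s : R) (v : C) (G : nat -> C) : s = 1 \/ s = -1 -> Lam v ->
  G (deg v) = G O ->
  (forall k, proj_coef (G k) (half_dir s v (S k)) = proj_coef (G (S k)) (half_dir s v (S k))) ->
  0 <= s * sum_f_R0 (fun k => tan (half_angle L v k) *
      Im ((opp v k - v) * G k ^ 2)%C) (pred (deg v)).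
Proof.
intros Hs Hv HG Hk. rewrite scal_sum.
assert (Hd := deg_pos v Hv).
rewrite sum_eq with (Bn := fun k => qform (half_dir s v (S k) - half_dir s v k)
  (proj_coef (G k) (half_dir s v k)) (proj_coef (G (S k)) (half_dir s v (S k))) * (2 * delta)).
2: { intros k _. rewrite <- Hk. rewrite (Rmult_comm _ (2 * delta)), <- term_qform by auto. ring. }
rewrite <- scal_sum. apply Rmult_le_pos; [lra |].
apply (qform_sum_nonneg (half_dir s v) (fun k => proj_coef (G k) (half_dir s v k))).
- intro k. generalize (polygon_turn hL k Hv). unfold half_dir. lra.
- replace (S (pred (deg v))) with (0 + deg v)%nat by lia.
  unfold half_dir. rewrite (polygon_period hL _ Hv). field.
(* After a full turn the cell is the initial one, but [half_dir] has grown by pi, half of 2 pi; this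
   produces the sign. *)
- replace (S (pred (deg v))) with (deg v) by lia. rewrite HG.
  unfold half_dir. change (deg v) with (0 + deg v)%nat.
  rewrite (polygon_period hL _ Hv).
  replace ((arg v 0 + 2 * PI) / 2 + s * (PI / 4)) with ((arg v 0 / 2 + s * (PI / 4)) + PI) by field.
  unfold proj_coef. rewrite neg_cos, neg_sin. ring.
Qed.

Lemma weight_pos (v : C) : Lam v -> 0 < weight delta L v.
Proof.
intros Hv. unfold weight.
assert (Hp : forall n, 0 < sum_f_R0 (fun k => sin (2 * half_angle L v k)) n).
{ assert (Ht : forall k, 0 < sin (2 * half_angle L v k)).
  { intro k. generalize (polygon_turn hL k Hv). intro. apply sin_gt_0; unfold half_angle; lra. }
  induction n as [| n IH]; simpl; [apply Ht | generalize (Ht (S n)); lra]. }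
specialize (Hp (pred (deg v))).
apply Rmult_lt_0_compat; [| exact Hp]. nra.
Qed.

(** * The discrete domain *)

Variables (Om : C -> Prop) (F : C -> C).
Hypotheses (hOm : discrete_domain delta L Om) (hsc : simply_connected Om)
  (hF : s_holomorphic delta L Om F).

Notation inner_cell := (inner_cell delta L Om).
Notation half_cell := (half_cell delta L Om).
Notation cell := (cell delta L Om).
Notation cell_edge := (cell_edge delta L Om).
Notation corner := (corner delta L Om).

Definition cell_primitive (z v : C) : R :=
  Im (F z ^ 2 * (v - z))%C +
  (if excluded_middle_informative (black L v) then delta * Cmod (F z) ^ 2 else 0).

Lemma cell_primitive_edge (z u w : C) : rhombus_edge delta L z u w ->
  cell_primitive z u - cell_primitive z w =
    2 * delta * Cmod (Proj (F z) (inv_sqrt (Ci * (w - u))%C)) ^ 2.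
Proof.
intros R. assert (Hl := edge_length z u w R). destruct R as (Hu & Hw & _).
rewrite (Proj_norm delta (F z) _ hdelta Hl). unfold cell_primitive.
destruct (excluded_middle_informative (black L u)) as [_ | N]; [| contradiction].
destruct (excluded_middle_informative (black L w)) as [Hb | _]; [clash |].
simpl. ring.
Qed.

Lemma cell_primitive_same_colour (z v v' : C) :
  (black L v /\ black L v') \/ (white L v /\ white L v') ->
  cell_primitive z v' - cell_primitive z v = Im ((v' - v) * F z ^ 2)%C.
Proof.
intros H. unfold cell_primitive.
destruct (excluded_middle_informative (black L v));
destruct (excluded_middle_informative (black L v'));
destruct H as [[? ?] | [? ?]]; try contradiction; try clash; simpl; ring.
Qed.

(** * Cells near a point of the domain *)

Definition in_cell (z x : C) : Prop := exists a b c d, rhombus z a b c d /\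
  ((inner_cell z /\ closed_rhombus a b d x) \/
   (half_cell z a /\ closed_triangle a b d x)).

Definition cell_interior (z x : C) : Prop := exists a b c d, rhombus z a b c d /\
  ((inner_cell z /\ open_rhombus a b d x) \/
   (half_cell z a /\ open_triangle a b d x)).

Lemma in_cell_cell (z x : C) : in_cell z x -> cell z.
Proof. intros (a & b & c & d & R & [[H _] | [H _]]); [left | right; exists a]; exact H. Qed.

Lemma in_cell_rhombus (z x : C) : in_cell z x ->
  exists a b c d, rhombus z a b c d /\ closed_rhombus a b d x.
Proof.
intros (a & b & c & d & R & [[_ H] | [_ H]]); exists a, b, c, d; split; auto.
now apply closed_triangle_rhombus.
Qed.

Lemma cell_interior_rhombus (z x : C) : cell_interior z x ->
  exists a b c d, rhombus z a b c d /\ open_rhombus a b d x.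
Proof.
intros (a & b & c & d & R & [[_ H] | [_ H]]); exists a, b, c, d; split; auto.
now apply open_triangle_rhombus.
Qed.

Lemma cell_interior_in (z x : C) : cell_interior z x -> in_cell z x.
Proof.
intros (a & b & c & d & R & [[I H] | [I H]]); exists a, b, c, d; split; auto.
- left. split; [exact I | now apply open_closed_rhombus].
- right. split; [exact I |]. destruct H as (s & t & ? & ? & ? & E).
  exists s, t. repeat split; try lra. exact E.
Qed.

Lemma inner_cell_Om (z a b c d x : C) : inner_cell z -> rhombus z a b c d ->
  open_rhombus a b d x -> Om x.
Proof.
intros (a' & b' & c' & d' & R' & H) R Hx. apply H.
exact (open_rhombus_rotation _ _ _ _ _ _ _ _ _ x R (rhombus_labels _ _ _ _ _ _ _ _ _ R R') Hx).
Qed.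

Lemma half_cell_spec (z a b c d : C) : half_cell z a -> rhombus z a b c d ->
  (forall x, open_triangle a b d x -> Om x) /\
  (forall x, segment b d x -> frontier Om x).
Proof.
intros (b' & c' & d' & R' & H) R.
destruct (rhombus_apex _ _ _ _ _ _ _ _ R R') as (-> & -> & ->). exact H.
Qed.

Lemma cell_interior_Om (z x : C) : cell_interior z x -> Om x.
Proof.
intros (a & b & c & d & R & [[I H] | [I H]]).
- now apply (inner_cell_Om z a b c d).
- now apply (half_cell_spec z a b c d I R).
Qed.

Lemma cell_interior_open (z x : C) : cell_interior z x -> locally x (cell_interior z).
Proof.
intros (a & b & c & d & R & H). assert (D := rhombus_det _ _ _ _ _ R).
destruct H as [[I H] | [I H]].
- generalize (open_rhombus_open a b d x D H). apply filter_imp. intros y Hy.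
  exists a, b, c, d. auto.
- generalize (open_triangle_open a b d x D H). apply filter_imp. intros y Hy.
  exists a, b, c, d. auto.
Qed.

Lemma frontier_not_Om (x : C) : frontier Om x -> ~ Om x.
Proof. intros [H _] Hx. apply H. exact (domain_open hOm Hx). Qed.

(** The centre lies on the boundary diagonal of a half-rhombus, hence outside [Om], but inside the
    open rhombus. *)
Lemma not_inner_half (z a : C) : inner_cell z -> half_cell z a -> False.
Proof.
intros I (b & c & d & R & _ & H). apply (frontier_not_Om z).
- apply H. exists (/ 2). split; [lra |].
  destruct (rhombus_eq _ _ _ _ _ R) as [-> ->]. C_field.
- apply (inner_cell_Om z a b c d z I R). now apply (center_in_rhombus z a b c d).
Qed.

Lemma convex_pos (x y t : R) : 0 < x -> 0 < y -> 0 <= t <= 1 -> 0 < x + t * (y - x).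
Proof.
intros Hx Hy Ht. destruct (Rle_dec x y).
- assert (0 <= t * (y - x)) by (apply Rmult_le_pos; lra). lra.
- assert (0 <= (1 - t) * (x - y)) by (apply Rmult_le_pos; lra). lra.
Qed.

(** Two half-rhombi on opposite sides of one diagonal would not form a convex set; [domain_no_slit]
    rules them out. *)
Lemma cell_interior_seg (z x y : C) (t : R) :
  cell_interior z x -> cell_interior z y -> 0 <= t <= 1 -> cell_interior z (seg x y t).
Proof.
intros (a & b & c & d & R & H) (a' & b' & c' & d' & R' & H') Ht.
destruct H as [[I H] | [I H]]; destruct H' as [[I' H'] | [I' H']].
- exists a, b, c, d. split; [exact R | left; split; [exact I |]].
  apply (open_rhombus_rotation _ _ _ _ _ _ _ _ _ y R'
    (rhombus_labels _ _ _ _ _ _ _ _ _ R' R)) in H'.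
  destruct H as (s1 & t1 & ? & ? & ->). destruct H' as (s2 & t2 & ? & ? & ->).
  exists (s1 + t * (s2 - s1)), (t1 + t * (t2 - t1)).
  assert (P1 := convex_pos s1 s2 t). assert (P2 := convex_pos t1 t2 t).
  assert (P3 := convex_pos (1 - s1) (1 - s2) t). assert (P4 := convex_pos (1 - t1) (1 - t2) t).
  split; [lra | split; [lra |]]. unfold seg. C_field.
- exfalso. now apply (not_inner_half z a').
- exfalso. now apply (not_inner_half z a).
- assert (E := domain_no_slit hOm I I'). subst a'.
  destruct (rhombus_apex _ _ _ _ _ _ _ _ R R') as (<- & <- & <-).
  exists a, b, c, d. split; [exact R | right; split; [exact I |]].
  destruct H as (s1 & t1 & ? & ? & ? & ->). destruct H' as (s2 & t2 & ? & ? & ? & ->).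
  exists (s1 + t * (s2 - s1)), (t1 + t * (t2 - t1)).
  assert (P1 := convex_pos s1 s2 t). assert (P2 := convex_pos t1 t2 t).
  assert (P3 := convex_pos (1 - s1 - t1) (1 - s2 - t2) t).
  split; [lra | split; [lra | split; [lra |]]]. unfold seg. C_field.
Qed.

Lemma cell_interior_nonempty (z : C) : cell z -> exists x, cell_interior z x.
Proof.
intros [I | (a & I)].
- assert (I' := I). destruct I' as (a & b & c & d & R & _).
  exists z, a, b, c, d. split; [exact R | left; split; [exact I |]].
  now apply (center_in_rhombus z a b c d).
- assert (I' := I). destruct I' as (b & c & d & R & _).
  exists (affine_pt a b d (/ 4) (/ 4)), a, b, c, d. split; [exact R | right; split; [exact I |]].
  exists (/ 4), (/ 4). repeat split; lra.
Qed.

Lemma cell_interior_unique (z z' x : C) : cell_interior z x -> in_cell z' x -> z' = z.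
Proof.
intros H H'. destruct (cell_interior_rhombus z x H) as (a & b & c & d & R & Hx).
destruct (in_cell_rhombus z' x H') as (a' & b' & c' & d' & R' & Hx').
exact (locally_singleton _ _ (open_rhombus_near z a b c d x R Hx) _ _ _ _ _ R' Hx').
Qed.

Lemma star_in_cell (v x : C) : star v x ->
  locally x (fun y => forall z, in_cell z y -> vertex_of z v).
Proof.
intros H. generalize (star_vertex_of v x H). apply filter_imp. intros y Hy z Hz.
destruct (in_cell_rhombus z y Hz) as (a & b & c & d & R & Hc). exact (Hy _ _ _ _ _ R Hc).
Qed.

(** Concerns the rhombus on one side of the edge, unique by [rhombus_on_edge]; the other side is
    obtained by exchanging [a] and [b]. A half-rhombus whose apex is not on the edge stays away from
    its inner points. *)
Lemma half_edge_near (a b : C) (s : R) : 0 < s < 1 ->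
  locally (seg a b s) (fun y => forall z c d, rhombus z a b c d -> in_cell z y ->
    inner_cell z \/ half_cell z a \/ half_cell z b).
Proof.
intros Hs.
destruct (classic (exists z c d, rhombus z a b c d)) as [(z & c & d & R) | N].
2: { apply filter_forall. intros y z c d R. exfalso. apply N. exists z, c, d. exact R. }
set (e := Rmin s (1 - s) / 2).
assert (He : 0 < e) by (unfold e; generalize (Rmin_glb_lt s (1 - s) 0); lra).
(* The two bounds give t' < s' and s' + t' < 1 near the point, which exclude the triangles with apex
   [d] and [c] respectively. *)
assert (He1 : 2 * e <= s) by (unfold e; generalize (Rmin_l s (1 - s)); lra).
assert (He2 : 2 * e <= 1 - s) by (unfold e; generalize (Rmin_r s (1 - s)); lra).
assert (Ex : seg a b s = affine_pt a b d s 0) by (unfold seg, affine_pt; C_field).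
generalize (locally_coords a b d _ s 0 e (rhombus_det _ _ _ _ _ R) He Ex).
apply filter_imp. intros y (s' & t' & Ey & H1 & H2) z' c' d' R' Hz.
apply Rabs_lt_bounds in H1, H2.
destruct (rhombus_on_edge _ _ _ _ _ _ _ _ R R') as (<- & <- & <-). clear R'.
assert (Ec := proj1 (rhombus_eq _ _ _ _ _ R)).
assert (D := rhombus_det _ _ _ _ _ R).
destruct Hz as (a1 & b1 & c1 & d1 & R1 & [[I _] | [I T]]); [auto |].
destruct (rhombus_labels _ _ _ _ _ _ _ _ _ R R1) as [H | [H | [H | H]]];
  destruct H as (-> & -> & -> & ->); auto; exfalso;
  destruct T as (p & q & Hp & Hq & Hpq & E).
- assert (E' : affine_pt a b d s' t' = affine_pt a b d (1 - p) (1 - q)).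
  { rewrite <- Ey, E, Ec. unfold affine_pt. C_field. }
  apply affine_pt_inj in E'; [lra | exact D].
- assert (E' : affine_pt a b d s' t' = affine_pt a b d q (1 - p)).
  { rewrite <- Ey, E, Ec. unfold affine_pt. C_field. }
  apply affine_pt_inj in E'; [lra | exact D].
Qed.

Definition has_edge (z a b : C) : Prop := cell_edge z a b \/ cell_edge z b a.

Lemma edge_near (z a b c d : C) (s : R) : rhombus z a b c d -> 0 < s < 1 ->
  locally (seg a b s) (fun y => forall z', in_cell z' y -> has_edge z' a b).
Proof.
intros R Hs.
assert (S1 : star a (seg a b s)).
{ apply (star_of_rhombus z a b c d _ s 0 R); [lra | lra |]. unfold seg, affine_pt. C_field. }
assert (R' : rhombus z b c d a) by (now do 3 apply rhombus_turn).
assert (S2 : star b (seg a b s)).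
{ apply (star_of_rhombus z b c d a _ 0 (1 - s) R'); [lra | lra |]. unfold seg, affine_pt. C_field. }
assert (Es : seg a b s = seg b a (1 - s)) by (unfold seg; C_field).
assert (N1 := half_edge_near a b s Hs).
assert (N2 := half_edge_near b a (1 - s) ltac:(lra)). rewrite <- Es in N2.
generalize (filter_and _ _ (filter_and _ _ N1 N2)
  (filter_and _ _ (star_in_cell a _ S1) (star_in_cell b _ S2))).
apply filter_imp. intros y [[H1 H2] [H3 H4]] z' Hz.
assert (V1 := H3 z' Hz). assert (V2 := H4 z' Hz).
assert (K : forall u w, rhombus_edge delta L z' u w ->
  ((u = a /\ w = b) \/ (u = b /\ w = a)) ->
  inner_cell z' \/ half_cell z' a \/ half_cell z' b).
{ intros u w (_ & _ & [(c1 & d1 & R1) | (b1 & c1 & R1)]) [[-> ->] | [-> ->]].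
  - exact (H1 _ _ _ R1 Hz).
  - destruct (H2 _ _ _ R1 Hz); tauto.
  - assert (R2 := rhombus_turn _ _ _ _ _ R1). destruct (H2 _ _ _ R2 Hz); tauto.
  - assert (R2 := rhombus_turn _ _ _ _ _ R1). exact (H1 _ _ _ R2 Hz). }
destruct (rhombus_colour _ _ _ _ _ R) as [(Ca & Cb & _) | (Ca & Cb & _)].
- right. assert (E := vertex_of_edge z' b a V2 V1 Cb Ca). split; [exact E |].
  destruct (K b a E); tauto.
- left. assert (E := vertex_of_edge z' a b V1 V2 Ca Cb). split; [exact E |].
  destruct (K a b E); tauto.
Qed.

(** A vertex, a point inside an edge, or a point inside a rhombus: the last two alternatives record
    only what all nearby cells have in common. *)
Lemma Om_cases (x : C) : Om x ->
  Lam x \/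
  (exists z, locally x (fun y => forall z', in_cell z' y -> z' = z)) \/
  (exists a b, locally x (fun y => forall z', in_cell z' y -> has_edge z' a b)).
Proof.
intros Hx. destruct (domain_composed hOm Hx) as (z & a0 & b0 & c0 & d0 & R0 & H0).
assert (Hz : in_cell z x) by (exists a0, b0, c0, d0; auto).
destruct (in_cell_rhombus z x Hz) as (a1 & b1 & c1 & d1 & R1 & H1).
destruct (closed_rhombus_star z a1 b1 c1 d1 x R1 H1)
  as (a & b & c & d & s & t & _ & R & Hs & Ht & E).
destruct (Req_dec s 0) as [-> | Hs0]; destruct (Req_dec t 0) as [-> | Ht0].
- left. replace x with a; [apply R |]. rewrite E. unfold affine_pt. C_field.
- right; right. exists d, a.
  replace x with (seg d a (1 - t)) by (rewrite E; unfold seg, affine_pt; C_field).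
  apply (edge_near z d a b c); [now apply rhombus_turn | lra].
- right; right. exists a, b.
  replace x with (seg a b s) by (rewrite E; unfold seg, affine_pt; C_field).
  apply (edge_near z a b c d); [exact R | lra].
- right; left. exists z.
  assert (O : open_rhombus a b d x) by (exists s, t; repeat split; try lra; exact E).
  generalize (open_rhombus_near z a b c d x R O). apply filter_imp.
  intros y Hy z' Hz'. destruct (in_cell_rhombus z' y Hz') as (a' & b' & c' & d' & R' & H').
  exact (Hy _ _ _ _ _ R' H').
Qed.

Lemma cell_primitive_edge_eq (z z' u w : C) : cell_edge z u w -> cell_edge z' u w ->
  cell_primitive z u - cell_primitive z w = cell_primitive z' u - cell_primitive z' w.
Proof.
intros E E'. rewrite (cell_primitive_edge z u w), (cell_primitive_edge z' u w)
  by (apply E || apply E').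
rewrite (hF _ _ _ _ E E'). reflexivity.
Qed.

Lemma has_edge_cases (z z' a b : C) : has_edge z a b -> has_edge z' a b ->
  exists u w, ((u = a /\ w = b) \/ (u = b /\ w = a)) /\ cell_edge z u w /\ cell_edge z' u w.
Proof.
intros [H | H] [H' | H'].
- exists a, b. auto.
- destruct H as ((? & ? & _) & _), H' as ((? & ? & _) & _). clash.
- destruct H as ((? & ? & _) & _), H' as ((? & ? & _) & _). clash.
- exists b, a. auto.
Qed.

Lemma cell_primitive_compat (a a' x : C) : Om x -> star a x -> star a' x ->
  locally x (fun y => forall z z', in_cell z y -> in_cell z' x ->
    cell_primitive z a - cell_primitive z a' = cell_primitive z' a - cell_primitive z' a').
Proof.
intros Hx S1 S2.
destruct (Om_cases x Hx) as [Hl | [(z0 & H) | (e & f & H)]].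
- rewrite <- (star_vertex a x Hl S1), <- (star_vertex a' x Hl S2).
  apply filter_forall. intros. ring.
- assert (H0 := locally_singleton _ _ H). generalize H. apply filter_imp.
  intros y Hy z z' Hz Hz'. rewrite (Hy z Hz), (H0 z' Hz'). reflexivity.
- assert (N := filter_and _ _ H (filter_and _ _ (star_in_cell a x S1) (star_in_cell a' x S2))).
  assert (N0 := locally_singleton _ _ N). generalize N. apply filter_imp.
  intros y (K1 & K2 & K3) z z' Hz Hz'. destruct N0 as (M1 & M2 & M3).
  destruct (has_edge_cases z z' e f (K1 z Hz) (M1 z' Hz')) as (u & w & _ & E & E').
  assert (P := cell_primitive_edge_eq z z' u w E E').
  assert (T : forall g, vertex_of z g -> vertex_of z' g -> g <> u -> g <> w -> z = z').
  { intros g Vg Vg'. destruct (edge_vertices z u w (proj1 E)), (edge_vertices z' u w (proj1 E')).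
    apply (third_vertex z z' u w g); auto; apply E. }
  assert (T1 := T a (K2 z Hz) (M2 z' Hz')). assert (T2 := T a' (K3 z Hz) (M3 z' Hz')).
  destruct (classic (a = u)) as [Ea | Ea]; [| destruct (classic (a = w)) as [Eb | Eb];
    [| rewrite (T1 Ea Eb); reflexivity]];
  (destruct (classic (a' = u)) as [Ea' | Ea']; [| destruct (classic (a' = w)) as [Eb' | Eb'];
    [| rewrite (T2 Ea' Eb'); reflexivity]]); subst; lra.
Qed.

(** * Gluing the functions of the cells *)

(** Several closed cells contain a point of an edge; a choice turns quantities attached to cells
    into functions on [Om]. *)
Definition chosen_cell (x : C) : C :=
  epsilon (inhabits (RtoC 0)) (fun z => in_cell z x).

Lemma chosen_cell_in (x : C) : Om x -> in_cell (chosen_cell x) x.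
Proof.
intros Hx. unfold chosen_cell. apply epsilon_spec.
destruct (domain_composed hOm Hx) as (z & a & b & c & d & R & H).
exists z, a, b, c, d. auto.
Qed.

Lemma Om_star (x : C) : Om x -> exists a, star a x.
Proof.
intros Hx. destruct (in_cell_rhombus _ _ (chosen_cell_in x Hx)) as (a1 & b1 & c1 & d1 & R1 & H1).
destruct (closed_rhombus_star _ a1 b1 c1 d1 x R1 H1)
  as (a & b & c & d & s & t & _ & R & Hs & Ht & E).
exists a. exact (star_of_rhombus _ a b c d x s t R Hs Ht E).
Qed.

(* [- cell_primitive z a] is the constant to be added to [cell_primitive z] for
   it to vanish at [a]; the primitive [h] of these local choices makes
   [h + cell_primitive] single-valued. *)
Lemma cell_primitive_glue : exists h : C -> R, forall a x, Om x -> star a x ->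
  locally x (fun y => h y + cell_primitive (chosen_cell y) a =
    h x + cell_primitive (chosen_cell x) a).
Proof.
destruct (primitive_exists (fun a x => Om x /\ star a x)
    (fun a y => - cell_primitive (chosen_cell y) a))
  with (D := Om) as (h & Hh).
- intros a x [Hx S]. exact (filter_and _ _ (domain_open hOm Hx) (star_open a x S)).
- intros a b x [Hx S] [_ S'].
  generalize (filter_and _ _ (domain_open hOm Hx) (cell_primitive_compat a b x Hx S S')).
  apply filter_imp. intros y [Hy H].
  specialize (H _ _ (chosen_cell_in y Hy) (chosen_cell_in x Hx)). lra.
- exact hsc.
- intros x. split.
  + intros Hx. destruct (Om_star x Hx) as [a S]. exists a. auto.
  + intros [a [Hx _]]. exact Hx.
- exists h. intros a x Hx S. generalize (Hh a x (conj Hx S)). apply filter_imp.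
  intros y Hy. lra.
Qed.

(** Lets a locally constant quantity be transported from an open cell to a vertex or to the midpoint
    of a side. *)
Definition adherent (z x : C) : Prop :=
  forall P : C -> Prop, locally x P -> exists y, cell_interior z y /\ P y.

Lemma adherent_dir (z x v : C) (e : R) : 0 < e ->
  (forall r, 0 < r < e -> cell_interior z (x + RtoC r * v)%C) -> adherent z x.
Proof.
intros He H P HP. destruct (locally_direction x v P HP) as (e' & He' & H').
set (r := Rmin e e' / 2).
assert (Hr : 0 < r) by (unfold r; generalize (Rmin_glb_lt e e' 0); lra).
assert (r < e /\ r < e') as [H1 H2].
{ generalize (Rmin_l e e') (Rmin_r e e'). unfold r in *. lra. }
exists (x + RtoC r * v)%C. split; [apply H | apply H']; lra.
Qed.

(** The ends of a boundary diagonal are frontier points, so a vertex in [Om] can only be the apex of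
    a half-rhombus. The opposite apex is excluded by a point of [Om] close to [v], which that half
    would have to contain. *)
Lemma cell_at_Om_vertex (z v b c d : C) : Om v -> rhombus z v b c d ->
  inner_cell z \/ half_cell z v.
Proof.
intros Hv R.
destruct (locally_direction v (b - v + (d - v)) _ (domain_open hOm Hv)) as (e & He & H).
set (r := Rmin e (/ 2) / 2).
assert (Hr : 0 < r) by (unfold r; generalize (Rmin_glb_lt e (/ 2) 0); lra).
assert (r < e /\ r < / 2) as [H1 H2].
{ generalize (Rmin_l e (/ 2)) (Rmin_r e (/ 2)). unfold r in *. lra. }
set (y := (v + RtoC r * (b - v + (d - v)))%C).
assert (Ey : y = affine_pt v b d r r) by (unfold y, affine_pt; C_field).
assert (Hy : Om y) by (apply H; lra).
destruct (domain_composed hOm Hy) as (z' & a1 & b1 & c1 & d1 & R1 & T).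
assert (O : open_rhombus v b d y) by (exists r, r; repeat split; try lra; exact Ey).
assert (Hin : in_cell z' y) by (exists a1, b1, c1, d1; auto).
assert (E : z' = z).
{ destruct (in_cell_rhombus z' y Hin) as (a2 & b2 & c2 & d2 & R2 & Hc).
  exact (locally_singleton _ _ (open_rhombus_near z v b c d y R O) _ _ _ _ _ R2 Hc). }
subst z'. destruct T as [[I _] | [I T]]; [left; exact I |].
assert (S := proj2 (half_cell_spec z a1 b1 c1 d1 I R1)).
assert (Sb := S b1). assert (Sd := S d1).
destruct (rhombus_labels _ _ _ _ _ _ _ _ _ R R1) as [K | [K | [K | K]]];
  destruct K as (-> & -> & -> & ->).
- right. exact I.
- exfalso. apply (frontier_not_Om v); [| exact Hv]. apply Sd.
  exists 1. split; [lra | ring].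
- exfalso. destruct T as (p & q & Hp & Hq & Hpq & E').
  assert (E2 : affine_pt v b d r r = affine_pt v b d (1 - p) (1 - q)).
  { rewrite <- Ey, E', (proj1 (rhombus_eq _ _ _ _ _ R)). unfold affine_pt. C_field. }
  apply affine_pt_inj in E2; [lra | exact (rhombus_det _ _ _ _ _ R)].
- exfalso. apply (frontier_not_Om v); [| exact Hv]. apply Sb.
  exists 0. split; [lra | ring].
Qed.

Lemma adherent_vertex (z v : C) : Om v -> vertex_of z v -> adherent z v.
Proof.
intros Hv (b & c & d & R).
apply (adherent_dir z v (b - v + (d - v)) (/ 2)); [lra |]. intros r Hr.
exists v, b, c, d. split; [exact R |].
destruct (cell_at_Om_vertex z v b c d Hv R) as [I | I]; [left | right]; (split; [exact I |]);
  exists r, r; repeat split; try lra; C_field.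
Qed.

Lemma cell_edge_apex (z u w : C) : cell_edge z u w -> exists a b c d,
  rhombus z a b c d /\ (inner_cell z \/ half_cell z a) /\
  (seg u w (/ 2) = affine_pt a b d (/ 2) 0 \/ seg u w (/ 2) = affine_pt a b d 0 (/ 2)).
Proof.
intros ((_ & _ & [(c & d & R) | (b & c & R)]) & [I | [I | I]]).
- exists u, w, c, d. repeat split; auto; try apply R. left. unfold seg, affine_pt. C_field.
- exists u, w, c, d. repeat split; auto; try apply R. left. unfold seg, affine_pt. C_field.
- assert (R' : rhombus z w c d u) by (now do 3 apply rhombus_turn).
  exists w, c, d, u. split; [exact R' |]. split; [auto |]. right. unfold seg, affine_pt. C_field.
- exists u, b, c, w. split; [exact R |]. split; [auto |]. right. unfold seg, affine_pt. C_field.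
- exists u, b, c, w. split; [exact R |]. split; [auto |]. right. unfold seg, affine_pt. C_field.
- exists w, u, b, c. split; [now apply rhombus_turn |]. split; [auto |].
  left. unfold seg, affine_pt. C_field.
Qed.

Lemma adherent_edge (z u w : C) : cell_edge z u w -> adherent z (seg u w (/ 2)).
Proof.
intros E. destruct (cell_edge_apex z u w E) as (a & b & c & d & R & I & Ex).
destruct Ex as [Ex | Ex]; rewrite Ex.
- apply (adherent_dir z _ (d - a) (/ 2)); [lra |]. intros r Hr.
  exists a, b, c, d. split; [exact R |].
  destruct I as [I | I]; [left | right]; (split; [exact I |]);
  exists (/ 2), r; repeat split; try lra; unfold affine_pt; C_field.
- apply (adherent_dir z _ (b - a) (/ 2)); [lra |]. intros r Hr.
  exists a, b, c, d. split; [exact R |].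
  destruct I as [I | I]; [left | right]; (split; [exact I |]);
  exists r, (/ 2); repeat split; try lra; unfold affine_pt; C_field.
Qed.

Lemma edge_star (z u w : C) : rhombus_edge delta L z u w ->
  star u (seg u w (/ 2)) /\ star w (seg u w (/ 2)).
Proof.
intros (_ & _ & [(c & d & R) | (b & c & R)]).
- split.
  + apply (star_of_rhombus z u w c d _ (/ 2) 0 R); try lra. unfold seg, affine_pt. C_field.
  + assert (R' : rhombus z w c d u) by (now do 3 apply rhombus_turn).
    apply (star_of_rhombus z w c d u _ 0 (/ 2) R'); try lra. unfold seg, affine_pt. C_field.
- split.
  + apply (star_of_rhombus z u b c w _ 0 (/ 2) R); try lra. unfold seg, affine_pt. C_field.
  + assert (R' := rhombus_turn _ _ _ _ _ R).
    apply (star_of_rhombus z w u b c _ (/ 2) 0 R'); try lra. unfold seg, affine_pt. C_field.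
Qed.

(** Were the midpoint outside [Om], it would be a frontier point, hence on a boundary diagonal of a
    rhombus. That rhombus would have [u] and [w] as vertices, and the midpoint of a side lies on no
    diagonal. *)
Lemma cell_edge_Om (z u w : C) : cell_edge z u w -> Om (seg u w (/ 2)).
Proof.
intros E. destruct (classic (Om (seg u w (/ 2)))) as [H | N]; [exact H | exfalso].
assert (Fr : frontier Om (seg u w (/ 2))).
{ split; intro H.
  - apply N. exact (locally_singleton _ _ H).
  - destruct (adherent_edge z u w E _ H) as (y & Hy & Ny). apply Ny.
    exact (cell_interior_Om z y Hy). }
destruct (domain_boundary hOm Fr) as (z' & a & b & c & d & R & _ & (t & Ht & Ex)).
assert (Ec := proj1 (rhombus_eq _ _ _ _ _ R)). assert (D := rhombus_det _ _ _ _ _ R).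
assert (Ex' : seg u w (/ 2) = affine_pt a b d (1 - t) t) by (rewrite Ex; unfold affine_pt; C_field).
assert (Hc : closed_rhombus a b d (seg u w (/ 2))).
{ exists (1 - t), t. repeat split; try lra. exact Ex'. }
destruct (edge_star z u w (proj1 E)) as [S1 S2].
assert (V1 := locally_singleton _ _ (star_vertex_of u _ S1) _ _ _ _ _ R Hc).
assert (V2 := locally_singleton _ _ (star_vertex_of w _ S2) _ _ _ _ _ R Hc).
destruct E as ((Hu & Hw & _) & _).
(* Coordinates on the diagonal sum to 1, whereas at the midpoints of the four sides the sum is 1/2
   or 3/2. *)
assert (K : forall s1 t1, seg u w (/ 2) = affine_pt a b d s1 t1 -> s1 + t1 = 1).
{ intros s1 t1 E1. rewrite Ex' in E1. apply affine_pt_inj in E1; lra. }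
destruct (rhombus_colour _ _ _ _ _ R) as [(Ca & Cb & Cc & Cd) | (Ca & Cb & Cc & Cd)];
destruct (vertex_of_cases _ _ _ _ _ _ R V1) as [E1 | [E1 | [E1 | E1]]]; subst u; try clash;
destruct (vertex_of_cases _ _ _ _ _ _ R V2) as [E2 | [E2 | [E2 | E2]]]; subst w; try clash;
first
 [ assert (X := K (/ 2) 0);
   specialize (X ltac:(rewrite ?Ec; unfold seg, affine_pt; C_field)); lra
 | assert (X := K 0 (/ 2));
   specialize (X ltac:(rewrite ?Ec; unfold seg, affine_pt; C_field)); lra
 | assert (X := K 1 (/ 2));
   specialize (X ltac:(rewrite ?Ec; unfold seg, affine_pt; C_field)); lra
 | assert (X := K (/ 2) 1);
   specialize (X ltac:(rewrite ?Ec; unfold seg, affine_pt; C_field)); lra ].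
Qed.

Lemma primitive_vertex_function : exists H : C -> C -> R,
  vertex_function delta L Om H /\ has_increments delta L Om F H.
Proof.
destruct cell_primitive_glue as (h & Hh).
(* Inside one cell [chosen_cell] has no freedom, so the added cell term is fixed and [h] is locally
   constant on a convex set. *)
assert (Hconst : forall z x y, cell_interior z x -> cell_interior z y -> h x = h y).
{ intros z x y Hx Hy. apply (locally_const_segment h). intros t Ht.
  assert (Ix := cell_interior_seg z x y t Hx Hy Ht).
  assert (Ox := cell_interior_Om z _ Ix).
  destruct (Om_star _ Ox) as [a S].
  generalize (filter_and _ _ (cell_interior_open z _ Ix) (Hh a _ Ox S)).
  apply filter_imp. intros y' [Iy E].
  assert (Oy := cell_interior_Om z y' Iy).
  rewrite (cell_interior_unique z _ y' Iy (chosen_cell_in y' Oy)) in E.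
  rewrite (cell_interior_unique z _ _ Ix (chosen_cell_in _ Ox)) in E. lra. }
set (k := fun z => h (epsilon (inhabits (RtoC 0)) (cell_interior z))).
assert (Hk : forall z x, cell_interior z x -> k z = h x).
{ intros z x Hx. unfold k. apply (Hconst z); [| exact Hx]. apply epsilon_spec. exists x. exact Hx. }
(* The right-hand side does not mention [z]: cells adherent to the same point of the star of [a]
   receive the same value at [a]. *)
assert (Hat : forall z a x, Om x -> star a x -> adherent z x ->
  k z + cell_primitive z a = h x + cell_primitive (chosen_cell x) a).
{ intros z a x Hx S A. destruct (A _ (Hh a x Hx S)) as (y & Iy & E).
  rewrite <- E, (Hk z y Iy).
  rewrite (cell_interior_unique z _ y Iy (chosen_cell_in y (cell_interior_Om z y Iy))).
  reflexivity. }
exists (fun z v => k z + cell_primitive z v). split.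
- intros v z0 z1 Hs. induction Hs as [z0 z1 Hs | z0 | z0 z1 _ IH | z0 z1 z2 _ IH1 _ IH2].
  + destruct Hs as ([_ V0] & [_ V1] & [Hv | (u & w & E0 & E1 & Hv)]).
    * assert (S := star_self v (vertex_of_Lam _ _ V0)).
      rewrite (Hat z0 v v Hv S (adherent_vertex z0 v Hv V0)).
      rewrite (Hat z1 v v Hv S (adherent_vertex z1 v Hv V1)). reflexivity.
    (* [v] itself may lie outside [Om]; the comparison is made at the midpoint of the common side,
       which is in the star of [v]. *)
    * assert (Om_e := cell_edge_Om z0 u w E0).
      assert (S : star v (seg u w (/ 2))).
      { destruct (edge_star z0 u w (proj1 E0)). destruct Hv as [-> | ->]; assumption. }
      rewrite (Hat z0 v _ Om_e S (adherent_edge z0 u w E0)).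
      rewrite (Hat z1 v _ Om_e S (adherent_edge z1 u w E1)). reflexivity.
  + reflexivity.
  + symmetry. exact IH.
  + congruence.
- intros z u w _ R. rewrite <- cell_primitive_edge by exact R. ring.
Qed.

(** * Uniqueness, diagonals and the sign of the Laplacian *)

(** The sides connect all vertices of a rhombus, so two solutions differ by a constant on each cell.
    With [cell_primitive] as one of them, every [H] inherits its diagonal increments. *)
Lemma increments_vertices (H1 H2 : C -> C -> R) (z v v' : C) :
  has_increments delta L Om F H1 -> has_increments delta L Om F H2 ->
  cell z -> vertex_of z v -> vertex_of z v' -> H1 z v - H2 z v = H1 z v' - H2 z v'.
Proof.
intros I1 I2 Hz V V'.
assert (K : forall u w, vertex_of z u -> vertex_of z w -> black L u -> white L w ->
  H1 z u - H2 z u = H1 z w - H2 z w).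
{ intros u w Vu Vw Hu Hw. assert (E := vertex_of_edge z u w Vu Vw Hu Hw).
  assert (E1 := I1 z u w Hz E). assert (E2 := I2 z u w Hz E). lra. }
assert (Vb : exists b, vertex_of z b /\
  ((black L v /\ white L b) \/ (white L v /\ black L b))).
{ destruct V as (b & c & d & R). exists b. split.
  - exists c, d, v. now do 3 apply rhombus_turn.
  - destruct (rhombus_colour _ _ _ _ _ R); tauto. }
destruct Vb as (b & Vb & Hb).
destruct (vertex_of_Lam _ _ V') as [Hv' | Hv']; destruct Hb as [[Hv Hb] | [Hv Hb]].
- rewrite (K v b), (K v' b); auto.
- symmetry. apply K; auto.
- apply K; auto.
- rewrite <- (K b v), <- (K b v'); auto.
Qed.

Lemma cell_primitive_increments : has_increments delta L Om F cell_primitive.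
Proof. intros z u w _ R. now apply cell_primitive_edge. Qed.

Lemma vertex_function_unique (H1 H2 : C -> C -> R) :
  vertex_function delta L Om H1 -> has_increments delta L Om F H1 ->
  vertex_function delta L Om H2 -> has_increments delta L Om F H2 ->
  exists c : R, forall z v, corner z v -> H1 z v = H2 z v + c.
Proof.
intros A1 I1 A2 I2.
set (k := fun z => let v := epsilon (inhabits (RtoC 0)) (vertex_of z) in H1 z v - H2 z v).
assert (Hk : forall z v, cell z -> vertex_of z v -> k z = H1 z v - H2 z v).
{ intros z v Hz V. apply (increments_vertices H1 H2 z); auto.
  apply epsilon_spec. exists v. exact V. }
assert (Sh : forall v z z', share_vertex delta L Om v z z' -> k z = k z').
{ intros v z z' S. assert (S' := S). destruct S' as ([Cz Vz] & [Cz' Vz'] & _).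
  rewrite (Hk z v Cz Vz), (Hk z' v Cz' Vz').
  rewrite (A1 v z z'), (A2 v z z') by (apply rst_step; exact S). reflexivity. }
(* The difference of the two solutions is one constant per cell, equal for cells sharing a vertex;
   it is now seen as a locally constant function on the path-connected set [Om]. *)
assert (Lc : forall x, Om x ->
  locally x (fun y => forall z z', in_cell z y -> in_cell z' x -> k z = k z')).
{ intros x Hx. destruct (Om_cases x Hx) as [Hl | [(z0 & H) | (a & b & H)]].
  - assert (N := star_in_cell x x (star_self x Hl)).
    assert (N0 := locally_singleton _ _ N). generalize N. apply filter_imp.
    intros y Hy z z' Hz Hz'. apply (Sh x). split; [| split].
    + split; [exact (in_cell_cell z y Hz) | exact (Hy z Hz)].
    + split; [exact (in_cell_cell z' x Hz') | exact (N0 z' Hz')].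
    + left. exact Hx.
  - assert (H0 := locally_singleton _ _ H). generalize H. apply filter_imp.
    intros y Hy z z' Hz Hz'. rewrite (Hy z Hz), (H0 z' Hz'). reflexivity.
  - assert (H0 := locally_singleton _ _ H). generalize H. apply filter_imp.
    intros y Hy z z' Hz Hz'.
    destruct (has_edge_cases z z' a b (Hy z Hz) (H0 z' Hz')) as (u & w & _ & E & E').
    apply (Sh u). split; [| split].
    + split; [exact (in_cell_cell z y Hz) | apply (edge_vertices z u w), E].
    + split; [exact (in_cell_cell z' x Hz') | apply (edge_vertices z' u w), E'].
    + right. exists u, w. auto. }
assert (Lx : forall z x, Om x -> in_cell z x -> k z = k (chosen_cell x)).
{ intros z x Hx Hz.
  exact (locally_singleton _ _ (Lc x Hx) z _ Hz (chosen_cell_in x Hx)). }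
destruct (domain_nonempty hOm) as [x0 Hx0].
exists (k (chosen_cell x0)). intros z v [Hz V].
destruct (cell_interior_nonempty z Hz) as [x Ix].
assert (Hx := cell_interior_Om z x Ix).
assert (E : k (chosen_cell x0) = k (chosen_cell x)).
{ destruct (proj1 hsc x0 x Hx0 Hx) as (g & Hc & Hg & <- & <-).
  apply (locally_const_eq (fun t => k (chosen_cell (g t)))).
  intros t Ht.
  assert (N : locally t (fun s => forall z z',
    in_cell z (g s) -> in_cell z' (g t) -> k z = k z')).
  { exact (Hc t _ (Lc (g t) (Hg t Ht))). }
  generalize N. apply filter_imp. intros s Hs Hs01. apply Hs; apply chosen_cell_in; auto. }
rewrite <- (Lx z x Hx (cell_interior_in z x Ix)) in E.
rewrite E, (Hk z v Hz V). ring.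
Qed.

Lemma increment_diagonal (H : C -> C -> R) (z v1 b v2 d : C) :
  has_increments delta L Om F H -> cell z -> rhombus z v1 b v2 d ->
  H z v2 - H z v1 = Im ((v2 - v1) * F ((v1 + v2) / 2) ^ 2)%C.
Proof.
intros I Hz R. assert (R' : rhombus z v2 d v1 b) by (now do 2 apply rhombus_turn).
rewrite <- (proj2 (rhombus_eq _ _ _ _ _ R)).
rewrite <- (cell_primitive_same_colour z v1 v2).
- assert (E := increments_vertices H cell_primitive z v1 v2 I cell_primitive_increments Hz).
  assert (V1 : vertex_of z v1) by (exists b, v2, d; exact R).
  assert (V2 : vertex_of z v2) by (exists d, v1, b; exact R').
  specialize (E V1 V2). lra.
- destruct (rhombus_colour _ _ _ _ _ R); tauto.
Qed.

Lemma laplacian_Om (H : C -> C -> R) (s : R) (v : C) :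
  has_increments delta L Om F H -> Om v ->
  (s = 1 /\ black L v) \/ (s = -1 /\ white L v) ->
  0 <= s * laplacian delta L H v.
Proof.
intros I Hv Hs.
assert (Hl : Lam v) by (unfold Defs.Lam; tauto).
assert (R : forall k, rhombus (center v k) v (nb v k) (opp v k) (nb v (S k))).
{ intro k. split; [exact Hl |]. exists k. auto. }
assert (Hz := fun k => cell_at_Om_vertex _ _ _ _ _ Hv (R k)).
assert (Hc : forall k, cell (center v k)).
{ intro k. destruct (Hz k) as [J | J]; [left; exact J | right; exists v; exact J]. }
unfold laplacian.
rewrite sum_eq with (Bn := fun k => tan (half_angle L v k) *
  Im ((opp v k - v) * F (center v k) ^ 2)%C).
2: { intros k _. rewrite (increment_diagonal H _ _ _ _ _ I (Hc k) (R k)). reflexivity. }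
assert (Hw := Rinv_0_lt_compat _ (weight_pos v Hl)).
rewrite (Rmult_comm s), Rmult_assoc. apply Rmult_le_pos; [lra |].
rewrite Rmult_comm. apply (laplacian_sign s v (fun k => F (center v k))); [tauto | exact Hl | |].
- unfold Defs.center, Defs.opp. f_equal.
  assert (E0 := nb_period v 0 1 Hl). assert (E1 := nb_period v 1 1 Hl).
  simpl in E0, E1. rewrite Nat.add_0_r in E0, E1. rewrite E0, E1. reflexivity.
(* The cells number [k] and [S k] at [v] share the edge towards [nb v (S k)], where s-holomorphicity
   is applied. *)
- intros k. apply (Proj_coef_eq delta _ _ _ hdelta).
  rewrite <- (edge_expi s v (S k)) by tauto.
  assert (V : vertex_of (center v k) (nb v (S k)) /\ vertex_of (center v (S k)) (nb v (S k))).
  { split.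
    - exists v, (nb v k), (opp v k). apply rhombus_turn, R.
    - exists (opp v (S k)), (nb v (S (S k))), v. do 3 apply rhombus_turn. apply R. }
  destruct V as [V V'].
  assert (W := vertex_of_center v k Hl). assert (W' := vertex_of_center v (S k) Hl).
  destruct Hs as [[-> Hb] | [-> Hb]].
  + assert (Hn := black_nb hL (S k) Hb).
    replace (Ci * 1 * (nb v (S k) - v))%C with (Ci * (nb v (S k) - v))%C by ring.
    apply hF; (split; [now apply vertex_of_edge |]).
    * destruct (Hz k); auto.
    * destruct (Hz (S k)); auto.
  + assert (Hn := white_nb hL (S k) Hb).
    (* At a white vertex the edge is traversed from white to black; [s = -1] restores the
       orientation i (w - u). *)
    replace (Ci * RtoC (-1) * (nb v (S k) - v))%C with (Ci * (v - nb v (S k)))%C by C_field.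
    apply hF; (split; [now apply vertex_of_edge |]).
    * destruct (Hz k); auto.
    * destruct (Hz (S k)); auto.
Qed.

End Lattice.

Theorem proposition3p6
  (delta eta : R) (L : lattice) (Om : C -> Prop) (F : C -> C)
  (hdelta : 0 < delta) (heta : 0 < eta)
  (hL : isoradial delta L) (hangles : angles_bounded L eta)
  (hOm : discrete_domain delta L Om) (hsc : simply_connected Om)
  (hF : s_holomorphic delta L Om F) :
  (* (i) *)
  ((forall z0 z1 u w, cell_edge delta L Om z0 u w -> cell_edge delta L Om z1 u w ->
      2 * delta * Cmod (Proj (F z0) (inv_sqrt (Ci * (w - u))%C)) ^ 2 =
      2 * delta * Cmod (Proj (F z1) (inv_sqrt (Ci * (w - u))%C)) ^ 2) /\
   (exists H : C -> C -> R,
      vertex_function delta L Om H /\ has_increments delta L Om F H) /\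
   (forall H1 H2 : C -> C -> R,
      vertex_function delta L Om H1 -> has_increments delta L Om F H1 ->
      vertex_function delta L Om H2 -> has_increments delta L Om F H2 ->
      exists c : R, forall z v, corner delta L Om z v -> H1 z v = H2 z v + c)) /\
  (forall H : C -> C -> R,
     vertex_function delta L Om H -> has_increments delta L Om F H ->
     (* (ii) *)
     (forall z v1 b v2 d, cell delta L Om z -> rhombus delta L z v1 b v2 d ->
        H z v2 - H z v1 = Im ((v2 - v1) * F ((v1 + v2) / 2) ^ 2)%C) /\
     (* (iii) *)
     (forall u, black L u -> Om u -> 0 <= laplacian delta L H u) /\
     (forall w, white L w -> Om w -> laplacian delta L H w <= 0)).
Proof.
split; [split; [| split] |].
- intros z0 z1 u w E0 E1. rewrite (hF _ _ _ _ E0 E1). reflexivity.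
- eapply primitive_vertex_function; eassumption.
- eapply vertex_function_unique; eassumption.
- intros H _ I. split; [| split].
  + intros z v1 b v2 d Hz R.
    exact (@increment_diagonal delta L hdelta hL Om F H z v1 b v2 d I Hz R).
  + intros u Hu Ou. rewrite <- Rmult_1_l.
    eapply laplacian_Om; try eassumption. auto.
  + intros w Hw Ow.
    assert (P : 0 <= -1 * laplacian delta L H w).
    { eapply laplacian_Om; try eassumption. auto. }
    lra.
Qed.
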